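(* Let $d\in\mathbb{N}$, $\mathcal{L}>0$ and $p\in[1,\infty)$. Let $\Phi:[0,\infty)\to[0,\infty)$ be a strictly increasing function such that $\Phi(0)=0$ and $\Phi(x)=O(x^{2/p})$ as $x\to+0$. Set $\Psi(x):=\left(x^{-1/p}\Phi(x)\right)^{1/2}$ for $x>0$. Assume that $f\in C^{0,1}(\mathbb{R}/\mathcal{L}\mathbb{Z},\mathbb{R}^d)\cap W^{1+\Psi,2p}(\mathbb{R}/\mathcal{L}\mathbb{Z},\mathbb{R}^d)$ is a closed embedded curve in $\mathbb{R}^d$ parametrized by arc-length. Then $f$ is bi-Lipschitz continuous.
   Context: For $s_1,s_2\in\mathbb{R}/\mathcal{L}\mathbb{Z}$, $|s_2-s_1|$ denotes the distance on the circle $\mathbb{R}/\mathcal{L}\mathbb{Z}$ (values in $[0,\mathcal{L}/2]$). ''Closed embedded curve parametrized by arc-length'' means that $f:\mathbb{R}/\mathcal{L}\mathbb{Z}\to\mathbb{R}^d$ is injective and $\|f'(s)\|_{\mathbb{R}^d}=1$ for almost every $s$; its total length is $\mathcal{L}$. The intrinsic distance $\mathscr{D}(f(s_1),f(s_2))$ is the length of the shorter of the two arcs of the curve joining $f(s_1)$ and $f(s_2)$, i.e. it equals $|s_2-s_1|$. For $q\in[1,\infty)$, $k\in\mathbb{N}\cup\{0\}$ and a measurable function $\Psi$, the space $W^{k+\Psi,q}(\mathbb{R}/\mathcal{L}\mathbb{Z},\mathbb{R}^d)$ is the set of $f$ in the usual Sobolev space $W^{k,q}(\mathbb{R}/\mathcal{L}\mathbb{Z},\mathbb{R}^d)$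 with $[f^{(k)}]_{\Psi,q}<\infty$, where $$[g]_{\Psi,q}:=\left(\iint_{(\mathbb{R}/\mathcal{L}\mathbb{Z})^2}\frac{\|g(s_2)-g(s_1)\|_{\mathbb{R}^d}^q}{\Psi(|s_2-s_1|)^q}\,\frac{1}{|s_2-s_1|}\,ds_2\,ds_1\right)^{1/q}.$$ (The value of $\Psi$ at $0$ is immaterial.) Thus here the condition is $f\in W^{1,2p}$ and $[f']_{\Psi,2p}<\infty$. $f$ is bi-Lipschitz continuous if it is Lipschitz and there exists $C_b>0$ such that $\|f(s_2)-f(s_1)\|_{\mathbb{R}^d}\ge C_b\,\mathscr{D}(f(s_1),f(s_2))$ for all $s_1,s_2\in\mathbb{R}/\mathcal{L}\mathbb{Z}$. *)

(* Defs.v *)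
From HB Require Import structures.
From mathcomp Require Import all_boot all_order all_algebra.
From mathcomp Require Import all_classical all_reals all_analysis.

Set Implicit Arguments.
Unset Strict Implicit.
Unset Printing Implicit Defensive.

Import Order.TTheory GRing.Theory Num.Theory.
Import numFieldNormedType.Exports.

Local Open Scope classical_set_scope.
Local Open Scope ring_scope.

(* A map on the circle R/LZ is represented by an L-periodic map on R; an
   integral over the circle is an integral over the fundamental domain [0, L[.
   The library's norm on 'rV[R]_d is the sup norm, hence [enorm]. *)

Definition enorm (R : realType) (d : nat) (v : 'rV[R]_d) : R :=
  Num.sqrt (\sum_(i < d) v 0 i ^+ 2).

(* The residue of s2 - s1 modulo L in [0, L[, i.e. the parameter length of the
   positively oriented arc of the circle going from s1 to s2. *)
Definition arc_param (R : realType) (L s1 s2 : R) : R :=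
  (s2 - s1) - (Num.floor ((s2 - s1) / L))%:~R * L.

Definition circle_dist (R : realType) (L s1 s2 : R) : R :=
  Num.min (arc_param L s1 s2) (arc_param L s2 s1).

(* Supremum of the lengths of the polygons inscribed in f on [a, b]; the points
   of a subdivision are listed as in the library's [variation]. *)
Definition curve_length (R : realType) (d : nat) (f : R -> 'rV[R]_d)
    (a b : R) : \bar R :=
  ereal_sup [set (\sum_(0 <= n < size l)
      enorm (f (nth b (a :: l) n.+1) - f (nth b (a :: l) n)))%:E
    | l in itv_partition a b].

(* The distance D(f s1, f s2) along the curve: the arc from s1 forward to s2
   and the arc from s2 forward to s1 are the two arcs joining f s1 and f s2. *)
Definition intrinsic_dist (R : realType) (d : nat) (L : R) (f : R -> 'rV[R]_d)
    (s1 s2 : R) : \bar R :=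
  Order.min (curve_length f s1 (s1 + arc_param L s1 s2))
            (curve_length f s2 (s2 + arc_param L s2 s1)).

Definition lipschitz_circle (R : realType) (d : nat) (L : R)
    (f : R -> 'rV[R]_d) : Prop :=
  exists C : R, forall s1 s2 : R,
    enorm (f s2 - f s1) <= C * circle_dist L s1 s2.

Definition bilipschitz_circle (R : realType) (d : nat) (L : R)
    (f : R -> 'rV[R]_d) : Prop :=
  lipschitz_circle L f /\
  exists Cb : R, 0 < Cb /\ forall s1 s2 : R,
    (Cb%:E * intrinsic_dist L f s1 s2 <= (enorm (f s2 - f s1))%:E)%E.

Definition closed_embedded_curve (R : realType) (d : nat) (L : R)
    (f : R -> 'rV[R]_d) : Prop :=
  periodic f L /\
  forall s1 s2 : R, 0 <= s1 < L -> 0 <= s2 < L -> f s1 = f s2 -> s1 = s2.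

Definition arclength_parametrized (R : realType) (d : nat)
    (f : R -> 'rV[R]_d) : Prop :=
  {ae lebesgue_measure, forall s : R,
    derivable f s 1 /\ enorm (derive1 f s) = 1}.

Definition Lq_circle (R : realType) (d : nat) (L q : R)
    (g : R -> 'rV[R]_d) : Prop :=
  [/\ periodic g L,
      forall i : 'I_d, measurable_fun setT (fun s : R => g s 0 i)
    & (\int[lebesgue_measure]_(s in `[0%R, L[) ((enorm (g s)) `^ q)%R%:E
       < +oo)%E].

Definition test_function (R : realType) (L : R) (phi : R -> R) : Prop :=
  periodic phi L /\ forall (n : nat) (s : R), derivable (derive1n n phi) s 1.

(* g is the k-th weak derivative of f on R/LZ. *)
Definition weak_derivative (R : realType) (d : nat) (L : R) (k : nat)
    (f g : R -> 'rV[R]_d) : Prop :=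
  forall phi : R -> R, test_function L phi -> forall i : 'I_d,
    \int[lebesgue_measure]_(s in `[0, L[) (f s 0 i * derive1n k phi s) =
    (-1) ^+ k * \int[lebesgue_measure]_(s in `[0, L[) (g s 0 i * phi s).

Definition sobolev (R : realType) (d : nat) (L : R) (k : nat) (q : R)
    (f : R -> 'rV[R]_d) : Prop :=
  Lq_circle L q f /\
  forall j : nat, (j <= k)%N ->
    exists2 g : R -> 'rV[R]_d, Lq_circle L q g & weak_derivative L j f g.

(* On the null set where s1 = s2 modulo L, 0^-1 = 0 makes the integrand 0. *)
Definition Psi_seminorm (R : realType) (d : nat) (L : R) (Psi : R -> R)
    (q : R) (g : R -> 'rV[R]_d) : \bar R :=
  ((\int[(lebesgue_measure \x lebesgue_measure)%E]_(z in
        (`[0%R, L[%classic `*` `[0%R, L[%classic : set (R * R)))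
      ((enorm (g z.2 - g z.1)) `^ q / (Psi (circle_dist L z.1 z.2)) `^ q
       * (circle_dist L z.1 z.2)^-1)%R%:E) `^ (q^-1))%E.

(* The space W^{k + Psi, q}; weak derivatives are unique a.e., so the choice of
   g is immaterial. *)
Definition sobolev_Psi (R : realType) (d : nat) (L : R) (k : nat)
    (Psi : R -> R) (q : R) (f : R -> 'rV[R]_d) : Prop :=
  sobolev L k q f /\
  exists g : R -> 'rV[R]_d,
    [/\ Lq_circle L q g, weak_derivative L k f g
      & (Psi_seminorm L Psi q g < +oo)%E].

Definition Psi_of (R : realType) (p : R) (Phi : R -> R) (x : R) : R :=
  (x `^ (- p^-1) * Phi x) `^ (2^-1).

(* Main.v *)
Require Import Defs.
From mathcomp Require Import all_boot all_order all_algebra.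
From mathcomp Require Import all_classical all_reals all_analysis.
From mathcomp Require Import measurable_realfun ring lra.
Import Order.TTheory GRing.Theory Num.Theory.
Import numFieldNormedType.Exports.
Local Open Scope classical_set_scope.
Local Open Scope ring_scope.

Set Implicit Arguments.
Unset Strict Implicit.
Unset Printing Implicit Defensive.

(** Only short chords can be dangerous: on pairs of points whose distance along
    the circle is bounded below, the chord length is a continuous positive
    function on a compact set, by injectivity ([far_chord]).

    For short arcs, let [g] be the weak derivative of [f]. A Lipschitz function
    is the integral of its pointwise derivative
    ([lipschitz_integral_derivative]), hence [g = f'] almost everywhere
    ([weak_derivative_lipschitz]); so [|g| = 1] almost everywhere and
    [f (s + h) - f s] is the integral of [g] over an arc [J] of length [h].
    Squaring, and using that [g x . g y = 1 - |g y - g x|^2 / 2] for unit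
    vectors,

      [|f (s + h) - f s|^2 = h^2 - 1/2 * iint_(J x J) |g y - g x|^2].

    Here the square of [a = |g y - g x|] is at most [1/2 + 2^(p-1) a^(2p)]
    (compare [dot_ge]), and the distance is at most [h] on [J x J]; the double
    integral is therefore at most
    [h^2 / 2 + 2^(p-1) h^2 * iint_(J x J) |g y - g x|^(2p) / dist^2].
    This last density is controlled by the seminorm: the growth condition on
    [Phi] says exactly that [Psi(t)^(2p) = Phi(t)^p / t] is [O(t)]
    ([Psi_of_le]). It is thus integrable near the diagonal, and its integral
    over the pairs at distance at most [delta] tends to 0 with [delta]
    ([near_energy_small]). Since that bound does not depend on the position of
    [J], every arc of length [h <= delta] has a chord of length at least [h / 2]
    ([near_chord]).

    Finally the length of an arc is at most the Lipschitz constant times its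
    parameter length ([curve_length_le]), so that lower bounds by the parameter
    distance are lower bounds by the intrinsic distance. *)

(** * Lipschitz functions are integrals of their derivatives *)

Lemma ae_imply (R : realType) (P Q : R -> Prop) :
  {ae lebesgue_measure, forall x : R, P x} -> (forall x, P x -> Q x) ->
  {ae lebesgue_measure, forall x : R, Q x}.
Proof.
move=> + PQ; apply: filterS => //.
exact: (ae_filter_ringOfSetsType lebesgue_measure).
Qed.

Lemma ae_and (R : realType) (P Q : R -> Prop) :
  {ae lebesgue_measure, forall x : R, P x} ->
  {ae lebesgue_measure, forall x : R, Q x} ->
  {ae lebesgue_measure, forall x : R, P x /\ Q x}.
Proof.
move=> aeP aeQ; apply: (@filterS2 _ _ _ _ _ _ _ aeP aeQ) => //.
exact: (ae_filter_ringOfSetsType lebesgue_measure).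
Qed.

Lemma lipschitz_continuous (R : realType) (u : R -> R) (K : R) :
  (forall x y, `|u x - u y| <= K * `|x - y|) -> continuous u.
Proof.
move=> uK x; apply/cvgrPdist_le => e e0; near=> y.
have K0 : 0 <= `|K| by [].
apply: le_trans (uK _ _) _.
apply: (@le_trans _ _ ((`|K| + 1) * `|x - y|)).
  by apply: ler_wpM2r => //; rewrite (le_trans (ler_norm K))// lerDl.
rewrite mulrC -ler_pdivlMr; last by rewrite ltr_wpDl.
near: y.
apply: (@cvgr_dist_le _ _ _ (nbhs x) _ id x cvg_id (e / (`|K| + 1))).
by rewrite divr_gt0// ltr_wpDl.
Unshelve. all: by end_near. Qed.

Lemma continuous_integrable_itv (R : realType) (u : R -> R) (a b : R) :
  continuous u -> lebesgue_measure.-integrable `[a, b] (EFin \o u).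
Proof.
move=> cu; apply: continuous_compact_integrable; first exact: segment_compact.
exact: continuous_subspaceT.
Qed.

(** The lower limit [a - 1] makes the integral differentiable at [a] as well. *)
Lemma antiderivative (R : realType) (u : R -> R) (a : R) : continuous u ->
  exists U : R -> R, forall x, a <= x -> derivable U x 1 /\ derive1 U x = u x.
Proof.
move=> cu; exists (fun y => \int[lebesgue_measure]_(t in `[a - 1, y]) u t).
move=> x ax; apply: (@continuous_FTC1_closed _ u (a - 1) x (x + 1)).
- by rewrite ltrDl.
- exact: continuous_integrable_itv.
- by rewrite ltrBlDr (le_lt_trans ax)// ltrDl.
- exact: cu.
Qed.

(** The difference quotient of [u] is the derivative of the difference quotient
    of an antiderivative [U]; so no change of variables is needed to compute its
    integral. *)
Lemma integral_difference_quotient (R : realType) (u U : R -> R) (a b : R)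
    (h : R) : 0 < h -> a < b -> continuous u ->
  (forall x, a <= x -> derivable U x 1 /\ derive1 U x = u x) ->
  (\int[lebesgue_measure]_(x in `[a, b]) (h^-1 * (u (x + h) - u x))%:E)%E =
  (h^-1 * (U (b + h) - U b) - h^-1 * (U (a + h) - U a))%:E.
Proof.
move=> h0 ab cu dU.
pose V x := h^-1 * (U (x + h) - U x).
have dV x : a <= x -> is_derive x (1:R) V (h^-1 * (u (x + h) - u x)).
  move=> ax.
  have d1 : is_derive x (1:R) U (u x).
    by have [? <-] := dU x ax; rewrite derive1E; exact: derivableP.
  have d2 : is_derive (x + h) (1:R) U (u (x + h)).
    have [//|? <-] := dU (x + h) _; first by rewrite (le_trans ax)// lerDl ltW.
    by rewrite derive1E; exact: derivableP.
  have d3 : is_derive x (1:R) (fun y => U (y + h)) (u (x + h)).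
    have -> : u (x + h) = u (x + h) * 1 by rewrite mulr1.
    apply: (@is_derive1_comp _ U (shift h)).
    exact: is_derive_shift.
  exact: (@is_deriveZ _ _ _ (fun y => U (y + h) - U y)).
rewrite (_ : \int[_]_(x in _) _ = (V b)%:E - (V a)%:E)%E//.
apply: continuous_FTC2 => //.
- apply: continuous_subspaceT => x.
  apply: cvgM; first exact: cvg_cst.
  apply: cvgB; last exact: cu.
  exact: (@cvg_comp _ _ _ (shift h) u _ (nbhs (x + h)) _
    (cvgD cvg_id (cvg_cst h)) (cu (x + h))).
- split.
  + by move=> x; rewrite in_itv/= => /andP[/ltW ax _]; have [] := dV x ax.
  + apply: cvg_at_right_filter; apply: differentiable_continuous.
    by apply/derivable1_diffP; have [] := dV a (lexx _).
  + apply: cvg_at_left_filter; apply: differentiable_continuous.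
    by apply/derivable1_diffP; have [] := dV b (ltW ab).
- move=> x; rewrite in_itv/= => /andP[/ltW ax _].
  by rewrite derive1E; have [_ ->] := dV x ax.
Qed.

Lemma cvg_harmonic_dnbhs (R : realType) : @harmonic R @ \oo --> (0 : R)^'.
Proof.
move=> A A0; have [N _ NA] := @cvg_harmonic R _ A0.
exists N => // n Nn; apply: NA => //.
by rewrite gt_eqF// /harmonic invr_gt0.
Qed.

Lemma harmonic_quotient_cvg (R : realType) (U : R -> R) (x : R) :
  derivable U x 1 ->
  (harmonic n)^-1 * (U (x + harmonic n) - U x) @[n --> \oo] --> derive1 U x.
Proof.
move=> dU.
have h : h^-1 *: (U (h *: 1 + x) - U x) @[h --> 0^'] --> derive1 U x.
  rewrite derive1E; exact: dU.
have := cvg_comp _ _ (@cvg_harmonic_dnbhs R) h.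
apply: cvg_trans; apply: near_eq_cvg; near=> n => /=.
by congr (_ * (U _ - _)); rewrite /GRing.scale/= mulr1 addrC.
Unshelve. all: by end_near. Qed.

Section lipschitz_ftc.
Context {R : realType} (u : R -> R) (K : R).
Hypothesis uK : forall x y, `|u x - u y| <= K * `|x - y|.
Hypothesis du : {ae lebesgue_measure, forall x : R, derivable u x 1}.

Let quot n x : R := (harmonic n)^-1 * (u (x + harmonic n) - u x).

Let cu : continuous u. Proof. exact: lipschitz_continuous uK. Qed.

Let quot_le n x : `|quot n x| <= K.
Proof.
have h0 : (0 : R) < harmonic n by rewrite /harmonic invr_gt0.
rewrite normrM gtr0_norm ?invr_gt0// mulrC ler_pdivrMr//.
by rewrite (le_trans (uK _ _))// addrAC subrr add0r gtr0_norm.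
Qed.

Let mquot n : measurable_fun setT (quot n).
Proof.
apply: continuous_measurable_fun => x.
apply: cvgM; first exact: cvg_cst.
apply: cvgB; last exact: cu.
exact: (@cvg_comp _ _ _ (shift (harmonic n)) u _ (nbhs (x + harmonic n)) _
  (cvgD cvg_id (cvg_cst _)) (@cu _)).
Qed.

(* The truncation to [- K, K] makes the bound hold at every point, also where the
   quotients do not converge. *)
Let D x := Num.max (- K) (Num.min K (limn_sup (quot ^~ x))).

Let DE x : derivable u x 1 -> D x = derive1 u x.
Proof.
move=> /harmonic_quotient_cvg dux.
have h : `|derive1 u x| <= K.
  apply: (ler_cvg_to (cvg_norm dux) (cvg_cst K)).
  by apply: nearW => n; exact: quot_le.
rewrite /D (cvg_limn_inf_sup dux).
by move: h; rewrite ler_norml => /andP[/max_r Kd /min_r ->].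
Qed.

Let mD : measurable_fun setT D.
Proof.
apply: measurable_maxr => //; apply: measurable_minr => //.
apply: measurable_fun_limn_sup => // x _.
- by exists K => _ [n _ <-]; have := quot_le n x; rewrite ler_norml => /andP[].
- by exists (- K) => _ [n _ <-]; have := quot_le n x; rewrite ler_norml => /andP[].
Qed.

Let D_le x : `|D x| <= K.
Proof.
have K0 : 0 <= K by exact: le_trans (quot_le 0 x).
rewrite ler_norml /D le_max lexx/= ge_max ge_min lexx/= andbT.
by rewrite (le_trans _ K0)// oppr_le0.
Qed.

(** Dominated convergence for the difference quotients, whose integrals tend to
    [u b - u a] by [integral_difference_quotient]. The pointwise derivative is
    only known to exist almost everywhere, hence the everywhere defined
    measurable representative [D']. *)
Lemma lipschitz_integral_derivative : exists D' : R -> R,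
  [/\ measurable_fun setT D', forall x, `|D' x| <= K,
    forall x, derivable u x 1 -> D' x = derive1 u x &
    forall a b, a < b ->
   (\int[lebesgue_measure]_(x in `[a, b]) (D' x)%:E = (u b - u a)%:E)%E].
Proof.
exists D; split=> // a b ab.
have [U dU] := antiderivative a cu.
have h0 n : (0 : R) < harmonic n by rewrite /harmonic invr_gt0.
have [_ _] : [/\ lebesgue_measure.-integrable `[a, b] (EFin \o D),
    (\int[lebesgue_measure]_(x in `[a, b]) `|(quot n x)%:E - (D x)%:E|)%E
      @[n --> \oo] --> 0%E &
    (\int[lebesgue_measure]_(x in `[a, b]) (quot n x)%:E)%E
      @[n --> \oo] --> (\int[lebesgue_measure]_(x in `[a, b]) (D x)%:E)%E].
  apply: (@dominated_convergence _ _ R lebesgue_measure `[a, b] _ _ _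
    (cst K%:E)).
  - exact: measurable_itv.
  - by move=> n; apply/measurable_EFinP; apply: measurable_funTS; exact: mquot.
  - by apply/measurable_EFinP; apply: measurable_funTS; exact: mD.
  - apply: (ae_imply du) => x dux _; apply: cvg_EFin; first by apply: nearW.
    by rewrite /comp/= DE//; exact: harmonic_quotient_cvg.
  - apply/integrableP; split; first exact: measurable_cst.
    rewrite integral_cst//= lebesgue_measure_itv/= lte_fin ab.
    by rewrite -EFinD -EFinM ltry.
  - by apply: aeW => x n _; rewrite lee_fin quot_le.
move=> dc; apply: (cvg_unique _ dc); first exact: ereal_hausdorff.
have E : (fun n => \int[lebesgue_measure]_(x in `[a, b]) (quot n x)%:E)%E =
    (fun n => ((harmonic n)^-1 * (U (b + harmonic n) - U b) -
              (harmonic n)^-1 * (U (a + harmonic n) - U a))%:E).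
  by apply/funext => n; exact: integral_difference_quotient.
rewrite E.
have [dUb Ub] := dU b (ltW ab).
have [dUa Ua] := dU a (lexx _).
rewrite -Ub -Ua.
apply: cvg_EFin; first by apply: nearW.
by apply: cvgB; exact: harmonic_quotient_cvg.
Qed.
End lipschitz_ftc.

(** * Smooth periodic functions approximating the indicator of an arc *)

(** A class of smooth functions that is visibly closed under differentiation and
    all of whose members are bounded, together with their derivatives. It is
    rich enough to approximate indicators of arcs, which makes compactly
    supported bump functions unnecessary. *)
Inductive exp_trig (R : realType) : (R -> R) -> Prop :=
| exp_trig_cst c : exp_trig (fun=> c)
| exp_trig_sin a b : exp_trig (fun x => sin (a * x + b))
| exp_trig_cos a b : exp_trig (fun x => cos (a * x + b))
| exp_trigD u v : exp_trig u -> exp_trig v -> exp_trig (fun x => u x + v x)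
| exp_trigM u v : exp_trig u -> exp_trig v -> exp_trig (fun x => u x * v x)
| exp_trig_expR u : exp_trig u -> exp_trig (fun x => expR (u x)).

Lemma is_derive_affine (R : realType) (a b x : R) :
  is_derive x 1 (fun x : R => a * x + b) a.
Proof.
rewrite [X in is_derive _ _ _ X](_ : a = a *: 1 + 0); last first.
  by rewrite addr0 /GRing.scale/= mulr1.
apply: (@is_deriveD _ _ _ (a \*: id) (cst b)).
Qed.

Lemma exp_trig_derivative (R : realType) (u : R -> R) : exp_trig u ->
  exists2 u', exp_trig u' & forall x : R, is_derive x 1 u (u' x).
Proof.
elim=> [c|a b|a b|v w _ [v' Sv' dv] _ [w' Sw' dw]|v w Sv [v' Sv' dv] Sw [w' Sw' dw]
  |v Sv [v' Sv' dv]].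
- exists (fun=> 0); first exact: exp_trig_cst.
  by move=> x; exact: is_derive_cst.
- exists (fun x => cos (a * x + b) * a).
    by apply: exp_trigM; [exact: exp_trig_cos|exact: exp_trig_cst].
  move=> x; apply: (@is_derive1_comp _ sin (fun x => a * x + b)).
  exact: is_derive_affine.
- exists (fun x => (-1 * sin (a * x + b)) * a).
    apply: exp_trigM; [|exact: exp_trig_cst].
    by apply: exp_trigM; [exact: exp_trig_cst|exact: exp_trig_sin].
  move=> x; rewrite mulN1r; apply: (@is_derive1_comp _ cos (fun x => a * x + b)).
  exact: is_derive_affine.
- exists (fun x => v' x + w' x); first exact: exp_trigD.
  by move=> x; exact: is_deriveD.
- exists (fun x => v x * w' x + w x * v' x).
    by apply: exp_trigD; exact: exp_trigM.
  by move=> x; exact: is_deriveM.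
- exists (fun x => expR (v x) * v' x).
    by apply: exp_trigM => //; exact: exp_trig_expR.
  by move=> x; apply: (@is_derive1_comp _ expR v).
Qed.

Lemma exp_trig_derive1 (R : realType) (u : R -> R) : exp_trig u ->
  exp_trig (derive1 u).
Proof.
move=> /exp_trig_derivative[u' Su' du].
rewrite (_ : derive1 u = u')//; apply/funext => x.
by rewrite derive1E; have [] := du x.
Qed.

Lemma exp_trig_derivable (R : realType) (u : R -> R) (x : R) : exp_trig u ->
  derivable u x 1.
Proof. by move=> /exp_trig_derivative[u' _ /(_ x)[]]. Qed.

Lemma exp_trig_test_function (R : realType) (L : R) (u : R -> R) :
  periodic u L -> exp_trig u -> test_function L u.
Proof.
move=> pu Su; split=> // n s; apply: exp_trig_derivable.
elim: n => [|n IH]; first by [].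
by rewrite /derive1n iterS; exact: exp_trig_derive1.
Qed.

Lemma exp_trig_bounded (R : realType) (u : R -> R) : exp_trig u ->
  exists M, forall x, `|u x| <= M.
Proof.
elim=> [c|a b|a b|v w _ [M vM] _ [N wN]|v w _ [M vM] _ [N wN]|v _ [M vM]].
- by exists `|c|.
- by exists 1 => x; rewrite ler_norml sin_geN1 sin_le1.
- by exists 1 => x; rewrite ler_norml cos_geN1 cos_le1.
- by exists (M + N) => x; rewrite (le_trans (ler_normD _ _))// lerD.
- by exists (M * N) => x; rewrite normrM ler_pM.
- exists (expR M) => x; rewrite gtr0_norm ?expR_gt0// ler_expR.
  by rewrite (le_trans (ler_norm _)).
Qed.

Lemma exp_trig_lipschitz (R : realType) (u : R -> R) : exp_trig u ->
  exists K, forall x y, `|u x - u y| <= K * `|x - y|.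
Proof.
move=> Su; have [u' Su' du] := exp_trig_derivative Su.
have [M u'M] := exp_trig_bounded Su'; exists M.
suff h x y : x < y -> `|u y - u x| <= M * `|y - x|.
  move=> x y; have [xy|xy|->] := ltgtP x y.
  - by rewrite distrC (distrC x); exact: h.
  - exact: h.
  - by rewrite !subrr normr0 mulr0.
move=> xy; have [|c _ ->] := @MVT _ u u' x y xy (fun z _ => du z).
  apply: continuous_subspaceT => z; apply: differentiable_continuous.
  by apply/derivable1_diffP; have [] := du z.
by rewrite normrM ler_wpM2r.
Qed.

Lemma exp_trig_continuous (R : realType) (u : R -> R) : exp_trig u ->
  continuous u.
Proof. by move=> /exp_trig_lipschitz[K]; exact: lipschitz_continuous. Qed.

(** Positive on the arc ]0, b[ and negative on ]b, L[. Each factor changes sign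
    under translation by [L], so that the product is [L]-periodic. *)
Definition arc_sign (R : realType) (L b x : R) : R :=
  sin (pi / L * x + 0) * sin (- (pi / L) * x + pi / L * b).

(** The function [t |-> exp (- exp (- n t))] tends to the indicator of
    [t > 0] away from [t = 0]. *)
Definition arc_cutoff (R : realType) (L b : R) (n : nat) (x : R) : R :=
  expR (-1 * expR (- n%:R * arc_sign L b x)).

Lemma arc_sign_periodic (R : realType) (L b : R) : 0 < L ->
  periodic (arc_sign L b) L.
Proof.
move=> L0 x; rewrite /arc_sign.
have -> : pi / L * (x + L) + 0 = pi / L * x + 0 + pi.
  by field; rewrite gt_eqF.
have -> : - (pi / L) * x + pi / L * b = - (pi / L) * (x + L) + pi / L * b + pi.
  by field; rewrite gt_eqF.
by rewrite !sinDpi mulrN mulNr.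
Qed.

Lemma arc_sign_gt0 (R : realType) (L b x : R) : 0 < x -> x < b -> b <= L ->
  0 < arc_sign L b x.
Proof.
move=> x0 xb bL; have L0 : 0 < L by rewrite (lt_le_trans _ bL)// (lt_trans x0).
rewrite /arc_sign addr0 mulNr addrC -mulrBr.
have h z : 0 < z -> z < L -> 0 < sin (pi / L * z).
  move=> z0 zL; apply: sin_gt0_pi.
  rewrite mulr_gt0 ?divr_gt0 ?pi_gt0//=.
  by rewrite mulrAC ltr_pdivrMr// ltr_pM2l ?pi_gt0.
apply: mulr_gt0; apply: h => //; first exact: lt_le_trans bL.
  by rewrite subr_gt0.
by rewrite (lt_le_trans _ bL)// ltrBlDr ltrDl.
Qed.

Lemma arc_sign_lt0 (R : realType) (L b x : R) : 0 <= b -> b < x -> x < L ->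
  arc_sign L b x < 0.
Proof.
move=> b0 bx xL; have L0 : 0 < L by rewrite (lt_trans _ xL)// (le_lt_trans b0).
rewrite /arc_sign addr0 mulNr addrC -mulrBr.
have h z : 0 < z -> z < L -> 0 < sin (pi / L * z).
  move=> z0 zL; apply: sin_gt0_pi.
  rewrite mulr_gt0 ?divr_gt0 ?pi_gt0//=.
  by rewrite mulrAC ltr_pdivrMr// ltr_pM2l ?pi_gt0.
rewrite -opprB mulrN sinN mulrN oppr_lt0; apply: mulr_gt0; apply: h => //.
- exact: le_lt_trans bx.
- by rewrite subr_gt0.
- by rewrite (le_lt_trans _ xL)// lerBlDr lerDl.
Qed.

Lemma arc_cutoff_exp_trig (R : realType) (L b : R) (n : nat) :
  exp_trig (arc_cutoff L b n).
Proof.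
apply: exp_trig_expR; apply: exp_trigM; first exact: exp_trig_cst.
apply: exp_trig_expR; apply: exp_trigM; first exact: exp_trig_cst.
by apply: exp_trigM; exact: exp_trig_sin.
Qed.

Lemma arc_cutoff_periodic (R : realType) (L b : R) (n : nat) : 0 < L ->
  periodic (arc_cutoff L b n) L.
Proof. by move=> L0 x; rewrite /arc_cutoff arc_sign_periodic. Qed.

Lemma arc_cutoff_bounds (R : realType) (L b : R) (n : nat) (x : R) :
  0 <= arc_cutoff L b n x <= 1.
Proof. by rewrite expR_ge0/= expR_le1 mulN1r oppr_le0 expR_ge0. Qed.

Lemma cvg_expRNn (R : realType) (c : R) : 0 < c ->
  expR (- n%:R * c) @[n --> \oo] --> (0 : R).
Proof.
move=> c0.
rewrite (_ : (fun n : nat => expR (- n%:R * c)) = (fun n => expR (- c) ^+ n)).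
  by apply: cvg_expr; rewrite gtr0_norm ?expR_gt0// expR_lt1 oppr_lt0.
by apply/funext => n; rewrite -expRM_natl mulrN mulNr.
Qed.

Lemma arc_cutoff_cvg1 (R : realType) (L b x : R) : 0 < arc_sign L b x ->
  arc_cutoff L b n x @[n --> \oo] --> (1 : R).
Proof.
move=> w0; rewrite -[X in _ --> X](@expR0 R) -(mulr0 (-1)).
apply: (cvg_comp _ expR); last exact: continuous_expR.
by apply: cvgM; [exact: cvg_cst|exact: cvg_expRNn].
Qed.

Lemma arc_cutoff_cvg0 (R : realType) (L b x : R) : arc_sign L b x < 0 ->
  arc_cutoff L b n x @[n --> \oo] --> (0 : R).
Proof.
move=> w0.
have c : (fun n => expR (- n%:R * - arc_sign L b x)) @ \oo --> (0 : R).
  by apply: cvg_expRNn; rewrite oppr_gt0.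
apply: (squeeze_cvgr _ (cvg_cst 0) c).
apply: nearW => n; rewrite expR_ge0/= /arc_cutoff ler_expR.
rewrite mulrN mulN1r lerN2.
by rewrite (le_trans _ (expR_ge1Dx _))// lerDr.
Qed.

(** * The weak derivative of a Lipschitz function *)

Lemma integrableM_bounded (R : realType) (D : set R) (f phi : R -> R) (M : R) :
  measurable D -> lebesgue_measure.-integrable D (EFin \o f) ->
  measurable_fun D phi -> (forall x, `|phi x| <= M) ->
  lebesgue_measure.-integrable D (EFin \o (fun x => f x * phi x)).
Proof.
move=> mD fi mphi phiM.
have -> : EFin \o (fun x => f x * phi x) = ((EFin \o f) \* (EFin \o phi))%E.
  by apply/funext => x /=; rewrite EFinM.
apply: integrableMl => //; exists M; split; first exact: num_real.
by move=> y My x _ /=; rewrite (le_trans (phiM x))// ltW.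
Qed.

Lemma integrable_bounded_itv (R : realType) (f : R -> R) (M : R) (a b : R) :
  measurable_fun setT f -> (forall x, `|f x| <= M) ->
  lebesgue_measure.-integrable `[a, b] (EFin \o f).
Proof.
move=> mf fM; apply: measurable_bounded_integrable.
- exact: measurable_itv.
- by rewrite /= lebesgue_measure_itv/=; case: ifPn => // _; rewrite -EFinD ltry.
- exact: measurable_funTS.
- exists M; split; first exact: num_real.
  by move=> y My x _ /=; rewrite (le_trans (fM x))// ltW.
Qed.

Lemma integrable_bounded_itv_co (R : realType) (f : R -> R) (M a b : R) :
  measurable_fun setT f -> (forall x, `|f x| <= M) ->
  lebesgue_measure.-integrable `[a, b[ (EFin \o f).
Proof.
move=> mf fM; apply: integrableS (integrable_bounded_itv a b mf fM) => //.
by move=> x /=; rewrite !in_itv/= => /andP[-> /ltW].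
Qed.

Lemma ae_neq (R : realType) (a : R) :
  {ae lebesgue_measure, forall x : R, x <> a}.
Proof.
exists [set a]; split; [exact: measurable_set1|exact: lebesgue_measure_set1|].
by move=> x /= /contrapT.
Qed.

Section du_bois_reymond.
Context {R : realType} (L : R) (h : R -> R).
Hypothesis L0 : 0 < L.
Hypothesis hi : lebesgue_measure.-integrable `[0, L[ (EFin \o h).
Hypothesis h_ortho : forall phi, periodic phi L -> exp_trig phi ->
  \int[lebesgue_measure]_(x in `[0, L[) (h x * phi x) = 0.

(** Testing against [arc_cutoff L b n] and letting [n] tend to infinity. *)
Lemma du_bois_reymond_itv (b : R) : 0 < b -> b < L ->
  \int[lebesgue_measure]_(x in `[0, b]) h x = 0.
Proof.
move=> b0 bL.
have sub : `]0, b[ `<=` `[0, L[.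
  by move=> x /=; rewrite !in_itv/= => /andP[/ltW -> /lt_trans]; exact.
have mh : measurable_fun `[0, L[ h.
  by apply/measurable_EFinP; exact: measurable_int hi.
have mhb : measurable_fun `]0, b[ h by exact: measurable_funS mh.
have [_ _] : [/\ lebesgue_measure.-integrable `[0%R, L[ (EFin \o (h \_ `]0%R, b[)),
    (\int[lebesgue_measure]_(x in `[0%R, L[)
       `|(h x * arc_cutoff L b n x)%:E - ((h \_ `]0%R, b[) x)%:E|)%E
      @[n --> \oo] --> 0%E &
    (\int[lebesgue_measure]_(x in `[0%R, L[) (h x * arc_cutoff L b n x)%:E)%E
      @[n --> \oo] -->
    (\int[lebesgue_measure]_(x in `[0%R, L[) ((h \_ `]0%R, b[) x)%:E)%E].
  apply: (@dominated_convergence _ _ R lebesgue_measure `[0%R, L[ _ _ _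
    (fun x => `|h x|%:E)).
  - exact: measurable_itv.
  - move=> n; apply/measurable_EFinP; apply: measurable_funM => //.
    apply: measurable_funTS; apply: continuous_measurable_fun.
    by apply: exp_trig_continuous; exact: arc_cutoff_exp_trig.
  - apply/measurable_EFinP/measurable_restrict => //.
    by rewrite setIidr.
  - apply: (ae_imply (ae_and (ae_neq 0) (ae_neq b))) => x [/eqP x0 /eqP xb].
      rewrite /= in_itv/= => /andP[x0' xL].
    have {x0 x0'}x0 : 0 < x by rewrite lt_neqAle eq_sym x0.
    apply: cvg_EFin; first by apply: nearW.
    rewrite /comp/= patchE.
    have [xb'|bx|xb'] := ltgtP x b; last by rewrite xb' eqxx in xb.
    + rewrite mem_set ?mulr1/=; last by rewrite in_itv/= x0.
      rewrite -[X in _ --> X]mulr1.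
      apply: cvgM; first exact: cvg_cst.
      by apply: arc_cutoff_cvg1; apply: arc_sign_gt0 => //; exact: ltW.
    + rewrite memNset/=; last by rewrite in_itv/= x0/= => /(lt_trans bx); rewrite ltxx.
      rewrite -[X in _ --> X](mulr0 (h x)).
      apply: cvgM; first exact: cvg_cst.
      by apply: arc_cutoff_cvg0; apply: arc_sign_lt0 => //; exact: ltW.
  - exact: integrable_norm.
  - apply: aeW => x n _; rewrite lee_fin normrM ler_piMr//.
    by have /andP[c0 c1] := arc_cutoff_bounds L b n x; rewrite ger0_norm.
move=> dc.
have cst0 n : (\int[lebesgue_measure]_(x in `[0%R, L[)
    (h x * arc_cutoff L b n x)%:E = 0)%E.
  have hc : lebesgue_measure.-integrable `[0, L[
      (EFin \o (fun x => h x * arc_cutoff L b n x)).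
    apply: (@integrableM_bounded _ _ _ _ 1) => //.
    + apply: measurable_funTS; apply: continuous_measurable_fun.
      by apply: exp_trig_continuous; exact: arc_cutoff_exp_trig.
    + move=> x; have /andP[c0 c1] := arc_cutoff_bounds L b n x.
      by rewrite ger0_norm.
  rewrite -[LHS]fineK; last exact: integrable_fin_num hc.
  congr EFin; apply: h_ortho; first exact: arc_cutoff_periodic.
  exact: arc_cutoff_exp_trig.
have {dc} : (\int[lebesgue_measure]_(x in `[0%R, L[) ((h \_ `]0%R, b[) x)%:E = 0)%E.
  apply/esym; apply: (cvg_unique _ _ dc); first exact: ereal_hausdorff.
  rewrite (_ : (fun n => _) = cst 0%E); first exact: cvg_cst.
  by apply/funext => n; exact: cst0.
move=> /(congr1 fine); rewrite -[LHS]/(Rintegral _ _ _) -Rintegral_mkcondr.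
rewrite setIidr// => hb; rewrite /Rintegral integral_itv_bndoo//.
exact/measurable_EFinP.
Qed.

(** The fundamental lemma of the calculus of variations, for the test functions of
    [exp_trig]: the integrals of [h] over the intervals from 0 to [b] vanish,
    and Lebesgue differentiation recovers [h] from them. *)
Lemma du_bois_reymond : {ae lebesgue_measure, forall x : R, 0 < x < L -> h x = 0}.
Proof.
pose h' := h \_ `[0, L[.
have h'i : lebesgue_measure.-integrable setT (EFin \o h').
  by rewrite -restrict_EFin; apply/(integrable_mkcond _ _).1 => //.
have loc : locally_integrable setT h'.
  by apply: open_integrable_locally => //; exact: openT.
have i y : lebesgue_measure.-integrable [set` Interval (BLeft 0) (BRight y)] (EFin \o h').
  by apply: integrableS h'i.
apply: (ae_imply (FTC1 i loc)) => x H /andP[x0 xL].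
have [|_] := H; first by rewrite lte_fin.
rewrite {2}/h' patchE mem_set/= ?in_itv/= ?(ltW x0)// => <-.
rewrite derive1E (@near_eq_derive _ _ _ _ (cst 0))//; first exact: derive_cst.
near=> y.
have : y \in `]0, L[ by near: y; apply: near_in_itvoo; rewrite in_itv/= x0.
rewrite in_itv/= => /andP[y0 yL].
rewrite -[RHS](du_bois_reymond_itv y0 yL); apply: eq_Rintegral => z.
rewrite inE/= in_itv/= => /andP[z0 zy].
by rewrite /h' patchE mem_set//= in_itv/= z0 (le_lt_trans zy).
Unshelve. all: by end_near. Qed.
End du_bois_reymond.

Lemma lipschitzM (R : realType) (u v : R -> R) (Ku Kv Mu Mv : R) :
  (forall x y, `|u x - u y| <= Ku * `|x - y|) ->
  (forall x y, `|v x - v y| <= Kv * `|x - y|) ->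
  (forall x, `|u x| <= Mu) -> (forall x, `|v x| <= Mv) ->
  forall x y, `|u x * v x - u y * v y| <= (Mu * Kv + Mv * Ku) * `|x - y|.
Proof.
move=> uK vK uM vM x y.
have -> : u x * v x - u y * v y = u x * (v x - v y) + v y * (u x - u y) by ring.
rewrite (le_trans (ler_normD _ _))// mulrDl lerD// normrM -mulrA ler_pM//.
Qed.

Section weak_derivative_lipschitz.
Context {R : realType} (L K M : R) (u g : R -> R).
Hypothesis L0 : 0 < L.
Hypothesis uK : forall x y, `|u x - u y| <= K * `|x - y|.
Hypothesis uM : forall x, `|u x| <= M.
Hypothesis pu : periodic u L.
Hypothesis du : {ae lebesgue_measure, forall x : R, derivable u x 1}.
Hypothesis mg : measurable_fun setT g.
Hypothesis gi : lebesgue_measure.-integrable `[0, L[ (EFin \o g).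
Hypothesis weak : forall phi, test_function L phi ->
  \int[lebesgue_measure]_(s in `[0, L[) (u s * derive1 phi s) =
  - \int[lebesgue_measure]_(s in `[0, L[) (g s * phi s).

(** The product of [u] and [phi] is Lipschitz and periodic, so its derivative
    integrates to 0 over a period. *)
Lemma integration_by_parts_periodic (D phi : R -> R) :
  measurable_fun setT D -> (forall x, `|D x| <= K) ->
  (forall x, derivable u x 1 -> D x = derive1 u x) ->
  periodic phi L -> exp_trig phi ->
  \int[lebesgue_measure]_(s in `[0, L[) (u s * derive1 phi s) =
  - \int[lebesgue_measure]_(s in `[0, L[) (D s * phi s).
Proof.
move=> mD DK DE pphi Sphi.
have [Kphi phiK] := exp_trig_lipschitz Sphi.
have [Mphi phiM] := exp_trig_bounded Sphi.
have [Mphi' phiM'] := exp_trig_bounded (exp_trig_derive1 Sphi).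
have cphi := exp_trig_continuous Sphi.
have cphi' := exp_trig_continuous (exp_trig_derive1 Sphi).
have cu := lipschitz_continuous uK.
have dM x : derivable u x 1 ->
    is_derive x 1 (fun y => u y * phi y) (u x * derive1 phi x + phi x * derive1 u x).
  move=> dux; rewrite !derive1E; apply: is_deriveM; apply: derivableP => //.
  exact: exp_trig_derivable.
have [D2 [mD2 D2K D2E int2]] := lipschitz_integral_derivative
  (lipschitzM uK phiK uM phiM)
  (ae_imply du (fun x h => @ex_derive _ _ _ _ _ _ _ (dM x h))).
have i1 : lebesgue_measure.-integrable `[0, L] (EFin \o (fun s => u s * derive1 phi s)).
  apply: integrableM_bounded phiM' => //.
    exact: continuous_integrable_itv.
  apply: measurable_funTS; exact: continuous_measurable_fun.
have i2 : lebesgue_measure.-integrable `[0, L] (EFin \o (fun s => D s * phi s)).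
  apply: integrableM_bounded phiM => //.
    exact: integrable_bounded_itv DK.
  apply: measurable_funTS; exact: continuous_measurable_fun.
have sub : `[0, L[ `<=` `[0, L].
  by move=> x /=; rewrite !in_itv/= => /andP[-> /ltW].
rewrite [LHS]Rintegral_itv_bndo_bndc; last exact: integrableS i1.
rewrite [in RHS]Rintegral_itv_bndo_bndc; last exact: integrableS i2.
apply/eqP; rewrite -addr_eq0 -RintegralD//.
have perL (v : R -> R) : periodic v L -> v L = v 0.
  by move=> pv; rewrite -[LHS](congr1 v (add0r L)) pv.
have := int2 0 L L0; rewrite (perL u)// (perL phi)// subrr => int0.
rewrite /Rintegral; apply/eqP; rewrite -[RHS]/(fine 0%:E) -int0; congr fine.
apply: ae_eq_integral => //.
- apply/measurable_EFinP; apply: measurable_funTS.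
  apply: measurable_funD; apply: measurable_funM => //;
  exact: continuous_measurable_fun.
- by apply/measurable_EFinP; apply: measurable_funTS.
- apply: (ae_imply du) => x dux _.
  have [dup e] := dM x dux.
  by rewrite D2E// [in RHS]derive1E e DE// [phi x * _]mulrC.
Qed.

(** Comparing with [integration_by_parts_periodic], the difference of [g] and the
    pointwise derivative is orthogonal to all test functions. *)
Lemma weak_derivative_lipschitz :
  {ae lebesgue_measure, forall x : R, 0 < x < L -> g x = derive1 u x} /\
  forall a b, 0 <= a -> a <= b -> b <= L ->
    \int[lebesgue_measure]_(x in `[a, b]) g x = u b - u a.
Proof.
have [D [mD DK DE intD]] := lipschitz_integral_derivative uK du.
have Di a b : lebesgue_measure.-integrable `[a, b] (EFin \o D).
  exact: integrable_bounded_itv DK.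
have Di' : lebesgue_measure.-integrable `[0, L[ (EFin \o D).
  apply: (integrableS _ _ _ (Di 0 L)) => //.
  by move=> x /=; rewrite !in_itv/= => /andP[-> /ltW].
have gD : {ae lebesgue_measure, forall x : R, 0 < x < L -> g x = D x}.
  have hi : lebesgue_measure.-integrable `[0, L[ (EFin \o (fun x => g x - D x)).
    rewrite (_ : _ \o _ = (EFin \o g) \- (EFin \o D))%E; first exact: integrableB.
    by apply/funext => x /=; rewrite EFinB.
  have := du_bois_reymond L0 hi; have ortho : forall phi, periodic phi L -> exp_trig phi ->
      \int[lebesgue_measure]_(x in `[0, L[) ((g x - D x) * phi x) = 0.
    move=> phi pphi Sphi.
    have [Mphi phiM] := exp_trig_bounded Sphi.
    have mphi : measurable_fun (`[0, L[ : set R) phi.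
      apply: measurable_funTS; apply: continuous_measurable_fun.
      exact: exp_trig_continuous.
    under eq_Rintegral do rewrite mulrBl.
    rewrite RintegralB//; try exact: integrableM_bounded phiM.
    apply/eqP; rewrite subr_eq0; apply/eqP/oppr_inj.
    rewrite -weak; last exact: exp_trig_test_function.
    by rewrite -integration_by_parts_periodic.
  move=> /(_ ortho) /ae_imply; apply => x + x0 => /(_ x0)/eqP.
  by rewrite subr_eq0 => /eqP.
split.
  by apply: (ae_imply (ae_and gD du)) => x [+ dux] x0 => /(_ x0) ->; exact: DE.
move=> a b a0 ab bL.
move: ab; rewrite le_eqVlt => /predU1P[->|ab].
  by rewrite set_itv1 Rintegral_set1 subrr.
rewrite -[RHS]/(fine (u b - u a)%:E) -intD// /Rintegral; congr fine.
apply: ae_eq_integral => //.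
- by apply/measurable_EFinP; exact: measurable_funTS.
- by apply/measurable_EFinP; exact: measurable_funTS.
- apply: (ae_imply (ae_and gD (ae_and (ae_neq 0) (ae_neq L)))) => x.
  move=> [gDx [/eqP x0 /eqP xL]]; rewrite /= in_itv/= => /andP[ax xb].
  rewrite gDx// !lt_neqAle xL eq_sym x0/= (le_trans a0 ax)/=.
  exact: le_trans bL.
Qed.
End weak_derivative_lipschitz.

(** * The energy density near the diagonal *)

Lemma enorm_ge0 (R : realType) (d : nat) (v : 'rV[R]_d) : 0 <= enorm v.
Proof. exact: sqrtr_ge0. Qed.

Lemma enorm_sqr (R : realType) (d : nat) (v : 'rV[R]_d) :
  enorm v ^+ 2 = \sum_(i < d) v 0 i ^+ 2.
Proof. by rewrite sqr_sqrtr// sumr_ge0// => i _; exact: sqr_ge0. Qed.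

Lemma arc_param_small (R : realType) (L x y : R) : x <= y -> y < x + L ->
  arc_param L x y = y - x.
Proof.
move=> xy yx; have L0 : 0 < L by rewrite -(ltrD2l x) addr0; apply: le_lt_trans yx.
rewrite /arc_param (@floor_def _ _ 0) ?mul0r ?subr0// add0r; apply/andP; split.
  by rewrite divr_ge0 ?subr_ge0// ltW.
by rewrite ltr_pdivrMr// mul1r ltrBlDl.
Qed.

Lemma arc_param_small_neg (R : realType) (L x y : R) : x < y -> y <= x + L ->
  arc_param L y x = x - y + L.
Proof.
move=> xy yx; have L0 : 0 < L by rewrite -(ltrD2l x) addr0; apply: lt_le_trans yx.
rewrite /arc_param (@floor_def _ _ (-1)) ?mulN1r ?opprK//; apply/andP; split.
  by rewrite ler_pdivlMr// mulN1r; lra.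
by rewrite ltr_pdivrMr// addNr mul0r subr_lt0.
Qed.

Lemma circle_distC (R : realType) (L x y : R) : circle_dist L x y = circle_dist L y x.
Proof. by rewrite /circle_dist minC. Qed.

(** On the fundamental domain the distance is an explicit continuous function,
    which is what makes it measurable. *)
Lemma circle_distE (R : realType) (L x y : R) : 0 <= x < L -> 0 <= y < L ->
  circle_dist L x y = Num.min `|x - y| (L - `|x - y|).
Proof.
wlog xy : x y / x <= y => [H|].
  move=> hx hy; have [/H|/ltW/H] := leP x y; first exact.
  by rewrite circle_distC distrC; exact.
move=> /andP[x0 xL] /andP[y0 yL].
have yx : y < x + L by lra.
rewrite /circle_dist arc_param_small//.
move: xy; rewrite le_eqVlt => /predU1P[<-|xy].
  rewrite arc_param_small// ?subrr ?normr0 ?subr0 ?minxx; last by lra.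
  by rewrite min_l// ltW// (le_lt_trans x0).
rewrite arc_param_small_neg// ?(ltW yx)//.
by rewrite ltr0_norm ?subr_lt0// opprB; congr Num.min; ring.
Qed.

(** The integral of a nonnegative function is a supremum over the simple
    functions below it, so monotonicity holds for arbitrary functions. It is
    used for the seminorm density, which involves [Phi] composed with the
    distance. *)
Lemma ge0_le_integral_nonmeasurable (d : measure_display) (T : measurableType d)
    (R : realType) (mu : {measure set T -> \bar R}) (D : set T)
    (f1 f2 : T -> \bar R) :
  (forall x, D x -> 0 <= f1 x)%E -> (forall x, D x -> f1 x <= f2 x)%E ->
  (\int[mu]_(x in D) f1 x <= \int[mu]_(x in D) f2 x)%E.
Proof.
move=> f10 f12.
have f20 x : D x -> (0 <= f2 x)%E by move=> Dx; exact: le_trans (f10 x Dx) (f12 x Dx).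
rewrite !ge0_integralE//; apply: ereal_sup_le => _ /= [h hf1 <-].
exists h => // x; apply: le_trans (hf1 x) _.
exact: lee_restrict.
Qed.

Lemma Psi_of_powR (R : realType) (p : R) (Phi : R -> R) (t : R) : 1 <= p ->
  0 < t -> 0 <= Phi t -> Psi_of p Phi t `^ (2 * p) = t^-1 * Phi t `^ p.
Proof.
move=> p1 t0 Phit; have p0 : p != 0 by rewrite gt_eqF// (lt_le_trans _ p1).
rewrite /Psi_of -powRrM mulrA mulVf ?pnatr_eq0// mul1r powRM ?powR_ge0//.
by rewrite -powRrM mulNr mulVf// powR_inv1// ltW.
Qed.

(** With [Phi t <= C t^(2/p)] the seminorm dominates the Gagliardo seminorm of the
    critical space [W^(1/(2p),2p)], whose density is [|g y - g x|^(2p) / dist^2]. *)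
Lemma Psi_of_le (R : realType) (p C : R) (Phi : R -> R) (t : R) : 1 <= p ->
  0 < t -> 0 <= C -> 0 <= Phi t -> Phi t <= C * t `^ (2 / p) ->
  Psi_of p Phi t `^ (2 * p) <= C `^ p * t.
Proof.
move=> p1 t0 C0 Phit PhiC.
have p0 : 0 < p by exact: lt_le_trans p1.
rewrite Psi_of_powR// mulrC ler_pdivrMr//.
apply: (@le_trans _ _ ((C * t `^ (2 / p)) `^ p)).
  by apply: ge0_ler_powR; rewrite ?nnegrE ?mulr_ge0 ?powR_ge0// ltW.
rewrite powRM ?powR_ge0// -powRrM divfK ?gt_eqF//.
by rewrite (powR_mulrn 2 (ltW t0)) expr2 mulrA.
Qed.

(** The circle distance on the fundamental domain, see [circle_distE]. *)
Definition gap (R : realType) (L : R) (z : R * R) : R :=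
  Num.min `|z.1 - z.2| (L - `|z.1 - z.2|).

(** The Gagliardo density of [W^(1/(2p),2p)], cut off at distance [e]. At distance
    0 the factor [gap L z `^ (- 2)] is 0. *)
Definition near_energy (R : realType) (d : nat) (L p : R) (g : R -> 'rV[R]_d)
    (e : R) (z : R * R) : R :=
  if gap L z <= e then enorm (g z.2 - g z.1) `^ (2 * p) * gap L z `^ (- 2) else 0.

Lemma measurable_gap (R : realType) (L : R) : measurable_fun setT (gap L).
Proof.
have m : measurable_fun setT (fun z : R * R => `|z.1 - z.2|).
  apply: measurableT_comp => //; apply: measurable_funB.
    exact: measurable_fst.
  exact: measurable_snd.
apply: measurable_minr => //; apply: measurable_funB => //.
Qed.

Lemma measurable_enormB (R : realType) (d : nat) (g : R -> 'rV[R]_d) :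
  (forall i, measurable_fun setT (fun s => g s 0 i)) ->
  measurable_fun setT (fun z : R * R => enorm (g z.2 - g z.1)).
Proof.
move=> mg; apply: measurableT_comp.
  by apply: continuous_measurable_fun; exact: sqrt_continuous.
apply: measurable_sum => i; apply: measurable_funX.
under eq_fun do rewrite !mxE.
apply: measurable_funB.
  exact: (measurableT_comp (mg i) measurable_snd).
exact: (measurableT_comp (mg i) measurable_fst).
Qed.

Lemma measurable_near_energy (R : realType) (d : nat) (L p e : R)
    (g : R -> 'rV[R]_d) :
  (forall i, measurable_fun setT (fun s => g s 0 i)) ->
  measurable_fun setT (near_energy L p g e).
Proof.
move=> mg; apply: measurable_fun_ifT.
- by apply: measurable_fun_ler => //; exact: measurable_gap.
- apply: measurable_funM.
    apply: (measurableT_comp (measurable_powR _)).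
    exact: measurable_enormB.
  exact: (measurableT_comp (measurable_powR _) (measurable_gap L)).
- exact: measurable_cst.
Qed.

Local Notation square L := (`[0%R, L[%classic `*` `[0%R, L[%classic).

Lemma bigO_right_bound (R : realType) (Phi w : R -> R) :
  Phi =O_ (0^'+) w -> (forall x, 0 <= w x) ->
  exists C e, [/\ 0 < C, 0 < e & forall x, 0 < x -> x <= e -> Phi x <= C * w x].
Proof.
move=> /eqO_exP[C C0 H] w0.
have [e /= e0 He] := H; exists C, (e / 2); split => //; first by rewrite divr_gt0.
move=> x x0 xe; have := He x; rewrite /ball_/= sub0r normrN gtr0_norm// => h.
have h2 : x < e by rewrite (le_lt_trans xe)// ltr_pdivrMr// mulr_natr mulr2n ltrDl.
by have := h h2 x0; rewrite (ger0_norm (w0 x)); apply: le_trans; exact: ler_norm.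
Qed.

Lemma gap_ge0 (R : realType) (L : R) (z : R * R) : square L z -> 0 <= gap L z.
Proof.
case: z => x y [/=]; rewrite !in_itv/= /gap/= => /andP[x0 xL] /andP[y0 yL].
rewrite le_min normr_ge0/= subr_ge0 ler_norml; apply/andP; split; lra.
Qed.

Lemma near_energy_ge0 (R : realType) (d : nat) (L p e : R) (g : R -> 'rV[R]_d) z :
  0 <= near_energy L p g e z.
Proof. by rewrite /near_energy; case: ifP => // _; rewrite mulr_ge0// powR_ge0. Qed.

Lemma near_energy0 (R : realType) (d : nat) (L p e : R) (g : R -> 'rV[R]_d) z :
  gap L z = 0 -> near_energy L p g e z = 0.
Proof.
move=> z0; rewrite /near_energy z0; case: ifP => // _.
by rewrite powR0 ?mulr0// oppr_eq0 pnatr_eq0.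
Qed.

Lemma near_energy_le (R : realType) (d : nat) (L p C e : R) (Phi : R -> R)
    (g : R -> 'rV[R]_d) (z : R * R) : 1 <= p -> 0 < C ->
  (forall x, 0 < x -> 0 < Phi x) ->
  (forall x, 0 < x -> x <= e -> Phi x <= C * x `^ (2 / p)) ->
  square L z ->
  (C `^ p)^-1 * near_energy L p g e z <=
  enorm (g z.2 - g z.1) `^ (2 * p) /
    Psi_of p Phi (circle_dist L z.1 z.2) `^ (2 * p) * (circle_dist L z.1 z.2)^-1.
Proof.
move=> p1 C0 Phi0 PhiC Sz.
have -> : circle_dist L z.1 z.2 = gap L z.
  by case: z Sz => x y []; rewrite /= !in_itv/=; exact: circle_distE.
have := gap_ge0 Sz; rewrite le_eqVlt => /predU1P[/esym t0|t0].
  by rewrite near_energy0// t0 invr0 !mulr0.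
rewrite /near_energy; case: ifPn => [te|_]; last first.
  by rewrite mulr0 !mulr_ge0 ?invr_ge0 ?powR_ge0// ltW.
rewrite powRN (powR_mulrn 2 (ltW t0)).
set a := enorm _ `^ _; set t := gap L z in t0 te *.
have a0 : 0 <= a by exact: powR_ge0.
have Psi0 : 0 < Psi_of p Phi t `^ (2 * p).
  rewrite Psi_of_powR//; last exact/ltW/Phi0.
  by rewrite mulr_gt0 ?invr_gt0// powR_gt0// Phi0.
have -> : (C `^ p)^-1 * (a * (t ^+ 2)^-1) = a * (C `^ p * t)^-1 * t^-1.
  by field; rewrite !gt_eqF ?powR_gt0.
rewrite ler_pM2r ?invr_gt0// ler_wpM2l// lef_pV2 ?posrE//; last first.
  by rewrite mulr_gt0 ?powR_gt0.
by apply: Psi_of_le => //; [exact: ltW|exact/ltW/Phi0|exact: PhiC].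
Qed.

(** The seminorm controls the Gagliardo density only where the growth bound on
    [Phi] holds, that is at distance at most some [e]. *)
Lemma integrable_near_energy (R : realType) (d : nat) (L p : R) (Phi : R -> R)
    (g : R -> 'rV[R]_d) : 1 <= p ->
  (forall x, 0 < x -> 0 < Phi x) -> Phi =O_ (0^'+) (fun x : R => x `^ (2 / p)) ->
  (forall i, measurable_fun setT (fun s => g s 0 i)) ->
  (Psi_seminorm L (Psi_of p Phi) (2 * p) g < +oo)%E ->
  exists2 e, 0 < e & (lebesgue_measure \x lebesgue_measure)%E.-integrable
    (square L) (EFin \o near_energy L p g e).
Proof.
move=> p1 Phi0 PhiO mg.
rewrite /Psi_seminorm => /lty_poweRy.
have p0 : 0 < p by exact: lt_le_trans p1.
have -> : (2 * p)^-1 != 0 by rewrite invr_eq0 gt_eqF// mulr_gt0.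
move=> /(_ isT) fin.
have [C [e [C0 e0 PhiC]]] := bigO_right_bound PhiO (fun x => powR_ge0 _ _).
exists e => //; apply/integrableP; split.
  by apply/measurable_EFinP; apply: measurable_funTS; exact: measurable_near_energy.
have Cp0 : 0 < C `^ p by rewrite powR_gt0.
have : ((C `^ p)^-1%:E * \int[(lebesgue_measure \x lebesgue_measure)%E]_(z in
    square L) (near_energy L p g e z)%:E < +oo)%E.
  rewrite -ge0_integralZl//; last 4 first.
  - by apply: measurableX; exact: measurable_itv.
  - by apply/measurable_EFinP; apply: measurable_funTS; exact: measurable_near_energy.
  - by move=> z _; rewrite lee_fin near_energy_ge0.
  - by rewrite lee_fin invr_ge0 ltW.
  apply: le_lt_trans fin; apply: ge0_le_integral_nonmeasurable.
  - by move=> z _; rewrite lee_fin mulr_ge0 ?near_energy_ge0// invr_ge0 ltW.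
  - by move=> z Sz; rewrite lee_fin; exact: near_energy_le Sz.
under [X in (_ -> X < _)%E]eq_integral do
  rewrite gee0_abs ?lee_fin ?near_energy_ge0//.
rewrite !ltey; apply: contra => /eqP ->.
by rewrite gt0_muley// lte_fin invr_gt0.
Qed.

(** * Chords from the energy *)

(** Absolute continuity of the integral: off the diagonal the cut-off density vanishes
    once the cut-off is below the distance, and on the diagonal it is 0. *)
Lemma near_energy_small (R : realType) (d : nat) (L p e : R) (g : R -> 'rV[R]_d)
    (eps : R) : 0 < e -> 0 < eps ->
  (forall i, measurable_fun setT (fun s => g s 0 i)) ->
  (lebesgue_measure \x lebesgue_measure)%E.-integrable
    (square L) (EFin \o near_energy L p g e) ->
  exists delta, [/\ 0 < delta,
    (lebesgue_measure \x lebesgue_measure)%E.-integrable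
      (square L) (EFin \o near_energy L p g delta) &
    (\int[(lebesgue_measure \x lebesgue_measure)%E]_(z in square L)
      (near_energy L p g delta z)%:E <= eps%:E)%E].
Proof.
move=> e0 eps0 mg ie.
(* The minimum with [e] keeps the dominating function integrable. *)
pose dl n := Num.min e (harmonic n).
have dl0 n : 0 < dl n by rewrite lt_min e0/= /harmonic invr_gt0.
have le_e n z : near_energy L p g (dl n) z <= near_energy L p g e z.
  rewrite /near_energy; case: ifPn => [|_].
    by rewrite le_min => /andP[-> _].
  by case: ifP => // _; rewrite mulr_ge0// powR_ge0.
have cvg0 z : square L z -> (near_energy L p g (dl n) z)%:E @[n --> \oo] --> 0%E.
  move=> Sz; apply: cvg_EFin; first by apply: nearW.
  have := gap_ge0 Sz; rewrite le_eqVlt => /predU1P[/esym z0|z0].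
    rewrite (_ : _ \o _ = cst 0); first exact: cvg_cst.
    by apply/funext => n /=; rewrite near_energy0.
  apply: cvg_near_cst; have [N _ HN] := cvgr_lt 0 (@cvg_harmonic R) _ z0.
  exists N => // n /HN /= hn; rewrite /near_energy ifN// -ltNge.
  by rewrite gt_min hn orbT.
have dom z n : square L z ->
    (`|(near_energy L p g (dl n) z)%:E| <= (near_energy L p g e z)%:E)%E.
  by move=> _; rewrite gee0_abs lee_fin ?near_energy_ge0.
have [_ _] : [/\ (lebesgue_measure \x lebesgue_measure)%E.-integrable (square L)
      (cst 0%E : R * R -> \bar R),
    (\int[(lebesgue_measure \x lebesgue_measure)%E]_(z in square L)
      `|(near_energy L p g (dl n) z)%:E - 0%E|)%E @[n --> \oo] --> 0%E &
    (\int[(lebesgue_measure \x lebesgue_measure)%E]_(z in square L)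
      (near_energy L p g (dl n) z)%:E)%E @[n --> \oo] -->
    (\int[(lebesgue_measure \x lebesgue_measure)%E]_(z in square L) cst 0%E z)%E].
  apply: (@dominated_convergence _ _ R (lebesgue_measure \x lebesgue_measure)%E
    _ _ (fun n => EFin \o near_energy L p g (dl n)) (cst 0%E)
    (EFin \o near_energy L p g e)) => //.
  - by apply: measurableX; exact: measurable_itv.
  - by move=> n; apply/measurable_EFinP; apply: measurable_funTS;
      exact: measurable_near_energy.
  - exact: aeW.
  - by apply: aeW => z n; exact: dom.
rewrite integral0 => /fine_cvgP[fin /(cvgr_le 0)/(_ eps eps0) le].
have [n [finn len]] : exists n, let I := (\int[(lebesgue_measure \x
    lebesgue_measure)%E]_(z in square L) (near_energy L p g (dl n) z)%:E)%E in
    I \is a fin_num /\ fine I <= eps.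
  by have [n _ /(_ n (leqnn n)) H] := filterI fin le; exists n.
exists (dl n); split => //.
- apply: le_integrable ie.
  + by apply: measurableX; exact: measurable_itv.
  + by apply/measurable_EFinP; apply: measurable_funTS; exact: measurable_near_energy.
  + by move=> z Sz; rewrite [leRHS]gee0_abs ?dom// lee_fin near_energy_ge0.
- by rewrite -(fineK finn) lee_fin.
Qed.

Section product_square.
Context {R : realType} (J : set R) (u : R -> R).
Hypothesis mJ : measurable J.
Hypothesis Jfin : (lebesgue_measure J < +oo)%E.
Hypothesis meas_u : measurable_fun setT u.
Hypothesis u1 : forall x, J x -> `|u x| <= 1.

Let v := u \_ J.

Let w (z : R * R) := u z.1 * u z.2.

Let wE : w \_ (J `*` J) = fun z => v z.1 * v z.2.
Proof.
apply/funext => -[x y]; rewrite /v /w !patchE in_setX/=.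
by case: (x \in J); case: (y \in J); rewrite ?mulr0 ?mul0r.
Qed.

Let vi : lebesgue_measure.-integrable setT (EFin \o v).
Proof.
rewrite -restrict_EFin; apply/(integrable_mkcond _ _).1; first exact: mJ.
apply: measurable_bounded_integrable => //; first exact: measurable_funTS.
exists 1; split; first exact: num_real.
by move=> M M1 x Jx /=; rewrite (le_trans (u1 Jx))// ltW.
Qed.

Lemma integrable_product_square :
  (lebesgue_measure \x lebesgue_measure)%E.-integrable (J `*` J) (EFin \o w).
Proof.
apply: measurable_bounded_integrable.
- exact: measurableX.
- rewrite /= product_measure1E//= lte_mul_pinfty//.
  by rewrite ge0_fin_numE.
- apply: measurable_funTS; apply: measurable_funM.
    exact: (measurableT_comp meas_u measurable_fst).
  exact: (measurableT_comp meas_u measurable_snd).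
- exists 1; split; first exact: num_real.
  move=> M M1 [x y] [/= Jx Jy] /=; rewrite (le_trans _ (ltW M1))//.
  by rewrite normrM -[leRHS]mul1r ler_pM// u1.
Qed.

(** Fubini for [u x * u y] on a square. *)
Lemma integral_product_square :
  \int[(lebesgue_measure \x lebesgue_measure)%E]_(z in J `*` J) w z =
  (\int[lebesgue_measure]_(x in J) u x) ^+ 2.
Proof.
have wi : (lebesgue_measure \x lebesgue_measure)%E.-integrable setT
    (EFin \o (fun z : R * R => v z.1 * v z.2)).
  rewrite -wE -restrict_EFin; apply/(integrable_mkcond _ _).1.
    exact: measurableX.
  exact: integrable_product_square.
have fV : (\int[lebesgue_measure]_x (v x)%:E)%E \is a fin_num.
  exact: integrable_fin_num vi.
rewrite [in RHS]Rintegral_mkcond -/v Rintegral_mkcond wE /Rintegral.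
rewrite -integral12_prod_meas1// /fubini_F/=.
under eq_integral do under eq_integral do rewrite EFinM.
under eq_integral do rewrite integralZl//.
by rewrite -[in LHS](fineK fV) integralZr// fineM// ?fineK// expr2.
Qed.
End product_square.

(** For unit vectors [v . w = 1 - |w - v|^2 / 2], and [|w - v|^2] is either at
    most [1/2] or dominated by a multiple of its [p]-th power. *)
Lemma dot_ge (R : realType) (d : nat) (p : R) (v w : 'rV[R]_d) : 1 <= p ->
  enorm v = 1 -> enorm w = 1 ->
  3 / 4 - 2 `^ p / 4 * enorm (w - v) `^ (2 * p) <= \sum_(i < d) v 0 i * w 0 i.
Proof.
move=> p1 v1 w1.
have dotE : \sum_(i < d) v 0 i * w 0 i = 1 - enorm (w - v) ^+ 2 / 2.
  rewrite enorm_sqr.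
  have -> : \sum_(i < d) (w - v) 0 i ^+ 2 =
      \sum_(i < d) w 0 i ^+ 2 + \sum_(i < d) v 0 i ^+ 2
      - 2 * \sum_(i < d) v 0 i * w 0 i.
    rewrite mulr_sumr -big_split/= -sumrB; apply: eq_bigr => i _.
    by rewrite !mxE; ring.
  by rewrite -!enorm_sqr v1 w1; field.
rewrite dotE; set a := enorm _.
have a0 : 0 <= a by exact: enorm_ge0.
suff : a ^+ 2 / 2 <= 1 / 4 + 2 `^ p / 4 * a `^ (2 * p) by lra.
rewrite powRrM (powR_mulrn 2 a0).
(* If [2 a^2 <= 1] the constant term suffices; otherwise [2 a^2] is at most its own
   [p]-th power. *)
have [le|gt] := leP (2 * a ^+ 2) 1.
  have : 0 <= 2 `^ p / 4 * (a ^+ 2) `^ p by rewrite mulr_ge0 ?divr_ge0 ?powR_ge0.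
  by move: le; lra.
have : 2 * a ^+ 2 <= (2 * a ^+ 2) `^ p by apply: le1r_powR => //; exact: ltW.
rewrite powRM ?sqr_ge0//.
lra.
Qed.

(** On pairs at distance at most [h] the factor [dist^-2] of the density is at least
    [h^-2]. *)
Lemma near_energy_ge (R : realType) (d : nat) (L p h delta : R)
    (g : R -> 'rV[R]_d) (z : R * R) : 1 <= p ->
  square L z -> gap L z <= h -> h <= delta ->
  enorm (g z.2 - g z.1) `^ (2 * p) <= h ^+ 2 * near_energy L p g delta z.
Proof.
move=> p1 Sz zh hd; have := gap_ge0 Sz.
rewrite le_eqVlt => /predU1P[/esym z0|z0].
  have -> : z.1 = z.2.
    case: z Sz z0 {zh} => x y [/=]; rewrite !in_itv/= => /andP[x0 xL] /andP[y0 yL].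
    rewrite /gap/=; case: (leP `|x - y|) => [_ /normr0_eq0/subr0_eq//|_].
    move=> /subr0_eq e; have : `|x - y| < L by rewrite ltr_norml; apply/andP; split; lra.
    by rewrite -e ltxx.
  rewrite subrr near_energy0// mulr0 /enorm.
  under eq_bigr do rewrite mxE expr0n/=.
  rewrite big1_eq sqrtr0 powR0// gt_eqF// mulr_gt0//.
  exact: lt_le_trans p1.
rewrite /near_energy (le_trans zh hd) mulrCA ler_peMr ?powR_ge0//.
rewrite powRN (powR_mulrn 2 (ltW z0)) ler_pdivlMr ?exprn_gt0// mul1r.
by rewrite ler_sqr ?nnegrE// ltW// (lt_le_trans z0).
Qed.

Lemma Rintegral_sum (disp : measure_display) (T : measurableType disp)
    (R : realType) (mu : {measure set T -> \bar R}) (D : set T) (I : Type)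
    (s : seq I) (f : I -> T -> R) :
  measurable D -> (forall i, mu.-integrable D (EFin \o f i)) ->
  mu.-integrable D (EFin \o (fun x => \sum_(i <- s) f i x)) /\
  \int[mu]_(x in D) (\sum_(i <- s) f i x) =
  \sum_(i <- s) \int[mu]_(x in D) f i x.
Proof.
move=> mD fi; elim: s => [|i s [IHi IH]].
  have -> : (fun x => \sum_(i <- [::]) f i x) = cst 0.
    by apply/funext => x; rewrite big_nil.
  by rewrite big_nil Rintegral_cst// mul0r; split => //; exact: integrable0.
have -> : (fun x => \sum_(j <- i :: s) f j x) =
    (fun x => f i x + \sum_(j <- s) f j x).
  by apply/funext => x; rewrite big_cons.
rewrite big_cons RintegralD// IH; split => //.
have -> : EFin \o (fun x => f i x + \sum_(j <- s) f j x) =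
    ((EFin \o f i) \+ (EFin \o (fun x => (\sum_(j <- s) f j x)%R)))%E.
  by apply/funext => x /=; rewrite EFinD.
exact: integrableD.
Qed.

Lemma le_Rintegral_affine (disp : measure_display) (T : measurableType disp)
    (R : realType) (mu : {measure set T -> \bar R}) (D : set T) (f E : T -> R)
    (a b c m : R) :
  measurable D -> mu D = m%:E ->
  mu.-integrable D (EFin \o f) -> mu.-integrable D (EFin \o E) ->
  0 <= c -> \int[mu]_(x in D) E x <= b ->
  (forall x, D x -> a - c * E x <= f x) ->
  a * m - c * b <= \int[mu]_(x in D) f x.
Proof.
move=> mD Dm fi Ei c0 Eb aEf.
have cEi : mu.-integrable D (EFin \o (fun x => c * E x)).
  have -> : EFin \o (fun x => c * E x) = (fun x => c%:E * (EFin \o E) x)%E.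
    by apply/funext => x /=; rewrite EFinM.
  exact: integrableZl.
have ai : mu.-integrable D (EFin \o (fun _ : T => a)).
  apply: measurable_bounded_integrable => //; first by rewrite Dm ltry.
  exists `|a|; split; first exact: num_real.
  by move=> M aM x _ /=; exact: ltW.
have di : mu.-integrable D (EFin \o (fun x => a - c * E x)).
  have -> : EFin \o (fun x => a - c * E x) =
      ((EFin \o (fun _ : T => a)) \- (EFin \o (fun x => (c * E x)%R)))%E.
    by apply/funext => x /=; rewrite EFinB.
  exact: integrableB.
apply: le_trans (le_Rintegral mD di fi aEf).
rewrite RintegralB// RintegralZl// Rintegral_cst// Dm/=.
by rewrite lerD2l lerN2 ler_wpM2l.
Qed.

(** The sum of the squares of the integrals of the coordinates of [g] is the double
    integral of [g x . g y]; [dot_ge] bounds it below by [3/4 h^2] minus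
    [2^p / 4 * h^2] times the energy, and the energy is at most [2^(-p)]. *)
Lemma mean_derivative_ge (R : realType) (d : nat) (L p h delta : R)
    (g : R -> 'rV[R]_d) (J : set R) : 1 <= p -> 0 < h -> h <= delta ->
  (forall i, measurable_fun setT (fun s => g s 0 i)) ->
  (lebesgue_measure \x lebesgue_measure)%E.-integrable
      (square L) (EFin \o near_energy L p g delta) ->
  (\int[(lebesgue_measure \x lebesgue_measure)%E]_(z in square L)
      (near_energy L p g delta z)%:E <= (2 `^ (- p))%:E)%E ->
  measurable J -> J `<=` `[0, L[ -> lebesgue_measure J = h%:E ->
  (forall x y, J x -> J y -> gap L (x, y) <= h) ->
  (forall x, J x -> enorm (g x) = 1) ->
  h ^+ 2 / 2 <= \sum_(i < d) (\int[lebesgue_measure]_(x in J) g x 0 i) ^+ 2.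
Proof.
move=> p1 h0 hd mg Ei Eint mJ Jsub Jh Jgap J1.
have Jfin : (lebesgue_measure J < +oo)%E by rewrite Jh ltry.
have g1 i x : J x -> `|g x 0 i| <= 1.
  move=> Jx; rewrite -sqrtr_sqr -[leRHS](J1 x Jx) /enorm ler_wsqrtr//.
  by rewrite (bigD1 i)//= lerDl sumr_ge0// => j _; exact: sqr_ge0.
have DS : J `*` J `<=` square L by move=> z [z1 z2]; split; exact: Jsub.
under eq_bigr => i _ do
  rewrite -(integral_product_square mJ Jfin (mg i) (@g1 i)).
have [Pi <-] := @Rintegral_sum _ _ R (lebesgue_measure \x lebesgue_measure)%E
  (J `*` J) _ (index_enum 'I_d) _ (measurableX mJ mJ)
  (fun i => integrable_product_square mJ Jfin (mg i) (@g1 i)).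
set c := 2 `^ p / 4 * h ^+ 2.
have c0 : 0 <= c by rewrite mulr_ge0 ?sqr_ge0// divr_ge0// powR_ge0.
have muJJ : ((lebesgue_measure \x lebesgue_measure)%E (J `*` J) = (h * h)%:E)%E.
  by rewrite product_measure1E// EFinM -Jh.
have EJ : (lebesgue_measure \x lebesgue_measure)%E.-integrable (J `*` J)
    (EFin \o near_energy L p g delta).
  apply: integrableS Ei => //; last exact: measurableX.
  by apply: measurableX; exact: measurable_itv.
have Esmall : \int[(lebesgue_measure \x lebesgue_measure)%E]_(z in J `*` J)
    near_energy L p g delta z <= 2 `^ (- p).
  rewrite -lee_fin fineK; last first.
    by apply: integrable_fin_num EJ; exact: measurableX.
  apply: le_trans Eint; apply: ge0_subset_integral => //.
  - exact: measurableX.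
  - by apply: measurableX; exact: measurable_itv.
  - by apply/measurable_EFinP; apply: measurable_funTS; exact: measurable_near_energy.
  - by move=> z _; rewrite lee_fin near_energy_ge0.
(* The value [2^(-p)] of the energy bound is chosen so that this identity holds. *)
have -> : h ^+ 2 / 2 = 3 / 4 * (h * h) - c * 2 `^ (- p).
  by rewrite /c powRN; field; rewrite gt_eqF// powR_gt0.
apply: (le_Rintegral_affine _ muJJ Pi EJ c0 Esmall); first exact: measurableX.
move=> [x y] [/= Jx Jy].
apply: le_trans (dot_ge p1 (J1 x Jx) (J1 y Jy)).
rewrite lerD2l lerN2 /c -[leRHS]mulrA ler_wpM2l ?divr_ge0 ?powR_ge0//.
by apply: (@near_energy_ge _ _ L p h delta g (x, y)) => //; [exact: DS|exact: Jgap].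
Qed.

(** * Distance and length on the circle, and long chords *)

Lemma le_coord_enorm (R : realType) (d : nat) (v : 'rV[R]_d) (i : 'I_d) :
  `|v 0 i| <= enorm v.
Proof.
rewrite -sqrtr_sqr ler_wsqrtr// (bigD1 i)//= lerDl.
by rewrite sumr_ge0// => j _; exact: sqr_ge0.
Qed.

Lemma enormN (R : realType) (d : nat) (v : 'rV[R]_d) : enorm (- v) = enorm v.
Proof. by congr Num.sqrt; apply: eq_bigr => i _; rewrite mxE sqrrN. Qed.

Lemma enorm_eq0 (R : realType) (d : nat) (v : 'rV[R]_d) : enorm v = 0 -> v = 0.
Proof.
move=> v0; apply/rowP => i; rewrite mxE; apply/normr0_eq0/eqP.
by rewrite eq_le normr_ge0 andbT -v0 le_coord_enorm.
Qed.

Lemma arc_param_ge0 (R : realType) (L x y : R) : 0 < L -> 0 <= arc_param L x y.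
Proof.
by move=> L0; rewrite subr_ge0 -ler_pdivlMr// floor_le.
Qed.

Lemma arc_param_lt (R : realType) (L x y : R) : 0 < L -> arc_param L x y < L.
Proof.
move=> L0; have := floorD1_gt ((y - x) / L).
by rewrite ltr_pdivrMr// intrD mulrDl mul1r /arc_param; lra.
Qed.

(** The two arcs between two points have total length [L], or 0 when the points
    coincide; hence the shorter one is at most [L / 2]. *)
Lemma arc_paramD_le (R : realType) (L x y : R) : 0 < L ->
  arc_param L x y + arc_param L y x <= L.
Proof.
move=> L0; have := arc_param_lt x y L0; have := arc_param_lt y x L0.
rewrite /arc_param.
have -> : y - x - (Num.floor ((y - x) / L))%:~R * L +
  (x - y - (Num.floor ((x - y) / L))%:~R * L) =
  (- Num.floor ((y - x) / L) - Num.floor ((x - y) / L))%:~R * L.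
  by rewrite intrB mulrNz; ring.
set a := _ * L; set b := _ * L; set k : int := - _ - _ => h1 h2.
have : k%:~R * L = (y - x - b) + (x - y - a).
  by rewrite /k /a /b intrB mulrNz; ring.
move=> e; rewrite -[leRHS]mul1r ler_pM2r// -[1]/(1%:~R) ler_int -ltzD1 -(ltr_int R).
rewrite -(ltr_pM2r L0) e.
have -> : (1 + 1)%:~R * L = L + L by rewrite intrD mulrDl mul1r.
by rewrite ltrD.
Qed.

Lemma circle_dist_ge0 (R : realType) (L x y : R) : 0 < L -> 0 <= circle_dist L x y.
Proof. by move=> L0; rewrite le_min !arc_param_ge0. Qed.

Lemma circle_dist_le (R : realType) (L x y : R) : 0 < L ->
  circle_dist L x y <= `|x - y|.
Proof.
move=> L0; wlog xy : x y / x <= y => [H|].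
  by have [/H//|/ltW/H] := leP x y; rewrite circle_distC distrC.
rewrite /circle_dist ge_min distrC ger0_norm ?subr_ge0//.
rewrite lerBlDr lerDl mulr_ge0 ?(ltW L0)// ler0z.
by rewrite floor_ge0 divr_ge0 ?subr_ge0// ltW.
Qed.

Lemma periodic_floor (R : realType) (T : Type) (L : R) (f : R -> T) (m : int) (x : R) :
  (forall y, f (y + L) = f y) -> f (x - m%:~R * L) = f x.
Proof.
move=> fL; have fn n y : f (y + n%:R * L) = f y.
  elim: n y => [|n IH] y; first by rewrite mul0r addr0.
  by rewrite -addn1 natrD mulrDl mul1r addrA fL.
case: m => n; first by rewrite -(fn n (x - _)) -pmulrn subrK.
by rewrite NegzE mulrNz mulNr opprK fn.
Qed.

(** Each segment of an inscribed polygon is at most [K] times its parameter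
    increment, and the increments telescope. *)
Lemma curve_length_le (R : realType) (d : nat) (f : R -> 'rV[R]_d) (K a b : R) :
  (forall x y, enorm (f x - f y) <= K * `|x - y|) ->
  (curve_length f a b <= (K * (b - a))%:E)%E.
Proof.
move=> fK; apply: ge_ereal_sup => _ [l [/(pathP b) ll /eqP lb] <-].
rewrite lee_fin.
apply: (@le_trans _ _ (\sum_(0 <= n < size l)
    (K * (nth b (a :: l) n.+1 - nth b (a :: l) n)))).
  rewrite big_nat_cond [leRHS]big_nat_cond; apply: ler_sum => n.
  rewrite andbT => /andP[_ nl].
  by rewrite (le_trans (fK _ _))// ger0_norm// subr_ge0 ltW// ll.
rewrite -mulr_sumr telescope_sumr//=.
by rewrite -[nth b (a :: l) (size l)]last_nth lb.
Qed.

(** The squared chord length is continuous and, by injectivity, positive on the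
    compact set of pairs [(s, h)] with [0 <= s <= L] and [delta <= h <= L / 2]. *)
Lemma far_chord (R : realType) (d : nat) (L delta : R) (f : R -> 'rV[R]_d) :
  0 < L -> 0 < delta -> delta <= L / 2 ->
  (forall i, continuous (fun x => f x 0 i)) ->
  closed_embedded_curve L f ->
  exists2 c, 0 < c & forall s h, 0 <= s -> s <= L -> delta <= h -> h <= L / 2 ->
    c <= enorm (f (s + h) - f s).
Proof.
move=> L0 d0 dL cf [pf inj].
pose Q (z : R * R) := \sum_(i < d) (f (z.1 + z.2) 0 i - f z.1 0 i) ^+ 2.
have QE s h : Q (s, h) = enorm (f (s + h) - f s) ^+ 2.
  by rewrite enorm_sqr; apply: eq_bigr => i _; rewrite !mxE.
have cQ : continuous Q.
  apply: continuous_big => [|i _ z]; first exact: add_continuous.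
  apply: (@cvg_comp _ _ _ _ (fun x => x ^+ 2)).
    apply: cvgB.
      apply: (@cvg_comp _ _ _ (fun w : R * R => w.1 + w.2) (fun x => f x 0 i)).
        by apply: cvgD; [exact: cvg_fst|exact: cvg_snd].
      exact: cf.
    apply: (@cvg_comp _ _ _ fst (fun x => f x 0 i)); first exact: cvg_fst.
    exact: cf.
  exact: exprn_continuous.
have [] := @compact_EVT_min _ R Q (`[0, L] `*` `[delta, L / 2]).
- by exists (0, delta); split; rewrite /= in_itv/= lexx ?(ltW L0)// dL.
- by apply: compact_setX; exact: segment_compact.
- exact: continuous_subspaceT.
move=> [s h]; rewrite inE => -[/=]; rewrite !in_itv/= => /andP[s0 sL] /andP[dh hL] minQ.
have Q0 : 0 < Q (s, h).
  rewrite QE exprn_gt0// lt_neqAle enorm_ge0 andbT eq_sym; apply/eqP => /enorm_eq0.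
  move=> /subr0_eq e.
  have hpos : 0 < h by exact: lt_le_trans dh.
  (* Injectivity is known on [0, L[, so the two parameters are reduced modulo [L]
     according to whether they exceed it. *)
  have [sL'|Ls] := ltP s L; last first.
    have {Ls sL}sL : s = L by apply/le_anti; rewrite sL.
    have f0 : f s = f 0 by rewrite sL -[X in f X]add0r pf.
    have fh : f (s + h) = f h by rewrite sL addrC pf.
    have : h = 0 by apply: inj; rewrite -?fh ?e ?f0//; apply/andP; split; lra.
    by lra.
  have [shL|Lsh] := ltP (s + h) L.
    have : s + h = s by apply: inj => //; apply/andP; split; lra.
    by lra.
  have fh : f (s + h - L) = f s by rewrite -e -[in RHS](subrK L (s + h)) pf.
  have : s + h - L = s by apply: inj => //; apply/andP; split; lra.
  by lra.
exists (Num.sqrt (Q (s, h))); first by rewrite sqrtr_gt0.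
move=> s' h' s'0 s'L dh' h'L; rewrite -[leRHS]ger0_norm ?enorm_ge0//.
rewrite -sqrtr_sqr -QE ler_wsqrtr//; apply: minQ.
by rewrite inE; split; rewrite /= in_itv/= ?s'0 ?dh'.
Qed.

(** * Short chords *)

(** Removing from [J] a null set outside which [g] is a unit vector changes neither
    the measure nor the integrals. *)
Lemma ae_mean_derivative_ge (R : realType) (d : nat) (L p h delta : R)
    (g : R -> 'rV[R]_d) (J : set R) : 1 <= p -> 0 < h -> h <= delta ->
  (forall i, measurable_fun setT (fun s => g s 0 i)) ->
  (forall i, lebesgue_measure.-integrable `[0, L[ (EFin \o (fun s => g s 0 i))) ->
  (lebesgue_measure \x lebesgue_measure)%E.-integrable
      (square L) (EFin \o near_energy L p g delta) ->
  (\int[(lebesgue_measure \x lebesgue_measure)%E]_(z in square L)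
      (near_energy L p g delta z)%:E <= (2 `^ (- p))%:E)%E ->
  {ae lebesgue_measure, forall x : R, 0 < x < L -> enorm (g x) = 1} ->
  measurable J -> J `<=` `[0, L[ -> lebesgue_measure J = h%:E ->
  (forall x y, J x -> J y -> gap L (x, y) <= h) ->
  h ^+ 2 / 2 <= \sum_(i < d) (\int[lebesgue_measure]_(x in J) g x 0 i) ^+ 2.
Proof.
move=> p1 h0 hd mg gi Ei Eint g1 mJ JL Jh Jgap.
have [N [mN N0 subN]] := ae_and g1 (ae_neq 0).
have JN : lebesgue_measure (J `\` N) = h%:E.
  have := measureDI (lebesgue_measure : measure _ R) mJ mN.
  rewrite -[LHS]/(lebesgue_measure J) Jh.
  rewrite [X in (_ + X)%E](subset_measure0 _ _ _ N0) ?adde0//.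
  exact: measurableI.
have intE i : \int[lebesgue_measure]_(x in J) g x 0 i =
    \int[lebesgue_measure]_(x in J `\` N) g x 0 i.
  congr fine; apply: negligible_integral => //.
  by apply: integrableS (gi i).
under eq_bigr do rewrite intE.
apply: (mean_derivative_ge p1 h0 hd mg Ei Eint) => //.
- exact: measurableD.
- by move=> x [/JL].
- by move=> x y [Jx _] [Jy _]; exact: Jgap.
- move=> x [/JL /=]; rewrite in_itv/= => /andP[x0 xL] Nx.
  have [gx /eqP x0'] : (0 < x < L -> enorm (g x) = 1) /\ x <> 0.
    by apply: contrapT => H; apply: Nx; exact: subN.
  by apply: gx; rewrite lt_neqAle eq_sym x0' x0.
Qed.

(** The arc from [s] to [s + h] may leave the fundamental domain; it is then cut at
    [L] and its second half moved back by [L]. *)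
Lemma near_chord (R : realType) (d : nat) (L p h delta : R)
    (g f : R -> 'rV[R]_d) (s : R) : 1 <= p -> 0 < h -> h <= delta -> h <= L ->
  (forall i, measurable_fun setT (fun s => g s 0 i)) ->
  (forall i, lebesgue_measure.-integrable `[0, L[ (EFin \o (fun s => g s 0 i))) ->
  (lebesgue_measure \x lebesgue_measure)%E.-integrable
      (square L) (EFin \o near_energy L p g delta) ->
  (\int[(lebesgue_measure \x lebesgue_measure)%E]_(z in square L)
      (near_energy L p g delta z)%:E <= (2 `^ (- p))%:E)%E ->
  {ae lebesgue_measure, forall x : R, 0 < x < L -> enorm (g x) = 1} ->
  (forall i a b, 0 <= a -> a <= b -> b <= L ->
    \int[lebesgue_measure]_(x in `[a, b]) g x 0 i = f b 0 i - f a 0 i) ->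
  periodic f L ->
  0 <= s -> s < L -> h / 2 <= enorm (f (s + h) - f s).
Proof.
move=> p1 h0 hd hL mg gi Ei Eint g1 ftc pf s0 sL.
suff [J [mJ JL Jh Jgap Jint]] : exists J : set R, [/\ measurable J, J `<=` `[0, L[,
    lebesgue_measure J = h%:E, (forall x y, J x -> J y -> gap L (x, y) <= h) &
    forall i, \int[lebesgue_measure]_(x in J) g x 0 i = f (s + h) 0 i - f s 0 i].
  have := ae_mean_derivative_ge p1 h0 hd mg gi Ei Eint g1 mJ JL Jh Jgap.
  under eq_bigr do rewrite Jint.
  have -> : \sum_(i < d) (f (s + h) 0 i - f s 0 i) ^+ 2 = enorm (f (s + h) - f s) ^+ 2.
    by rewrite enorm_sqr; apply: eq_bigr => i _; rewrite !mxE.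
  move=> H.
  have : (h / 2) ^+ 2 <= enorm (f (s + h) - f s) ^+ 2.
    by apply: le_trans H; rewrite exprMn; have := sqr_ge0 h; lra.
  by rewrite ler_sqr ?nnegrE ?enorm_ge0// divr_ge0// ltW.
have int_co i a b : 0 <= a -> a <= b -> b <= L ->
    \int[lebesgue_measure]_(x in `[a, b[) g x 0 i = f b 0 i - f a 0 i.
  move=> a0 ab bL; rewrite Rintegral_itv_bndo_bndc ?ftc//.
  apply: integrableS (gi i) => //; exact: subset_itv.
have [shL|Lsh] := leP (s + h) L.
  exists `[s, (s + h)[%classic; split.
  - exact: measurable_itv.
  - move=> x /=; rewrite !in_itv/= => /andP[sx xs].
    by rewrite (le_trans s0 sx) (lt_le_trans xs).
  - by rewrite /= lebesgue_measure_itv/= lte_fin ltrDl h0 -EFinD addrAC subrr add0r.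
  - move=> x y /=; rewrite !in_itv/= /gap/= ge_min => /andP[sx xs] /andP[sy ys].
    by apply/orP; left; rewrite ler_norml; apply/andP; split; lra.
  - by move=> i; apply: int_co => //; rewrite lerDl ltW.
have disj : [disjoint `[s, L[%classic & `[0, (s + h - L)[%classic].
  apply/disj_setPLR => x /=; rewrite !in_itv/= => /andP[sx xL].
  by apply/negP; rewrite negb_and -leNgt; apply/orP; right; lra.
exists (`[s, L[%classic `|` `[0, (s + h - L)[%classic); split.
- by apply: measurableU; exact: measurable_itv.
- by move=> x /= []; rewrite !in_itv/= => /andP[? ?]; apply/andP; split; lra.
- rewrite measureU//; last exact/disj_set2P.
  rewrite /= !lebesgue_measure_itv/= !lte_fin sL.
  rewrite ifT; last by lra.
  by rewrite -!EFinD; congr EFin; lra.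
- move=> x y /=; rewrite !in_itv/= /gap/= ge_min.
  move=> [] /andP[x1 x2] [] /andP[y1 y2]; apply/orP.
  + by left; rewrite ler_norml; apply/andP; split; lra.
  + by right; rewrite ger0_norm; lra.
  + by right; rewrite ler0_norm; lra.
  + by left; rewrite ler_norml; apply/andP; split; lra.
- move=> i; rewrite Rintegral_setU//.
  + rewrite !int_co//; try lra.
    have -> : f (s + h) = f (s + h - L) by rewrite -[in RHS]pf subrK.
    have -> : f L = f 0 by rewrite -[LHS](congr1 f (add0r L)) pf.
    by ring.
  + apply: integrableS (gi i) => //; first exact: measurableU.
    by move=> x /= []; rewrite !in_itv/= => /andP[? ?]; apply/andP; split; lra.
Qed.

(** * The bi-Lipschitz bound *)

Lemma Lq_circle_integrable (R : realType) (d : nat) (L q : R)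
    (g : R -> 'rV[R]_d) (i : 'I_d) : 1 <= q -> Lq_circle L q g ->
  lebesgue_measure.-integrable `[0, L[ (EFin \o (fun s => g s 0 i)).
Proof.
move=> q1 [_ mg gq].
have mpow : measurable_fun setT (fun s => enorm (g s) `^ q).
  apply: (measurableT_comp (measurable_powR _)).
  apply: (@measurableT_comp _ _ _ _ _ _ (@Num.sqrt R)).
    by apply: continuous_measurable_fun; exact: sqrt_continuous.
  by apply: measurable_sum => j; apply: measurable_funX.
have iq : lebesgue_measure.-integrable `[0, L[ (EFin \o (fun s => enorm (g s) `^ q)).
  apply/integrableP; split.
    by apply/measurable_EFinP; exact: measurable_funTS.
  by under eq_integral do rewrite gee0_abs ?lee_fin ?powR_ge0//.
have i1 : lebesgue_measure.-integrable `[0, L[ (EFin \o (fun _ : R => 1)).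
  apply: (@integrable_bounded_itv_co _ _ 1); first exact: measurable_cst.
  by move=> x; rewrite normr1.
apply: le_integrable (integrableD _ i1 iq) => //.
- by apply/measurable_EFinP; apply: measurable_funTS; exact: mg.
- move=> x _ /=; rewrite lee_fin [leRHS]ger0_norm ?addr_ge0 ?powR_ge0//.
  apply: le_trans (le_coord_enorm _ _) _.
  have [e1|/ltW e1] := leP (enorm (g x)) 1.
    by rewrite (le_trans e1)// lerDl powR_ge0.
  by rewrite (le_trans (le1r_powR e1 q1))// lerDr.
Qed.

Lemma lipschitz_circle_enorm (R : realType) (d : nat) (L : R)
    (f : R -> 'rV[R]_d) : 0 < L -> lipschitz_circle L f ->
  exists2 K, 0 < K & forall x y,
    enorm (f x - f y) <= K * circle_dist L x y.
Proof.
move=> L0 [C fC]; exists (`|C| + 1); first by rewrite ltr_wpDl.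
move=> x y; apply: le_trans (fC y x) _; rewrite circle_distC.
apply: ler_wpM2r; first exact: circle_dist_ge0.
by rewrite (le_trans (ler_norm _))// lerDl.
Qed.

(** [weak_derivative_lipschitz] in each coordinate: the speed of [g] is that of the
    pointwise derivative of [f], which is 1. *)
Lemma weak_derivative_unit_speed (R : realType) (d : nat) (L q : R)
    (f g : R -> 'rV[R]_d) : 0 < L -> 1 <= q ->
  lipschitz_circle L f -> periodic f L -> arclength_parametrized f ->
  Lq_circle L q g -> weak_derivative L 1 f g ->
  {ae lebesgue_measure, forall x : R, 0 < x < L -> enorm (g x) = 1} /\
  forall i a b, 0 <= a -> a <= b -> b <= L ->
    \int[lebesgue_measure]_(x in `[a, b]) g x 0 i = f b 0 i - f a 0 i.
Proof.
move=> L0 q1 f_lip pf f_arc gq wd.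
have [K K0 fK] := lipschitz_circle_enorm L0 f_lip.
have fi_lip i x y : `|f x 0 i - f y 0 i| <= K * `|x - y|.
  have := le_coord_enorm (f x - f y) i; rewrite !mxE => /le_trans; apply.
  by rewrite (le_trans (fK x y))// ler_wpM2l ?circle_dist_le// ltW.
have fi_bnd i x : `|f x 0 i| <= `|f 0 0 i| + K * L.
  rewrite -lerBlDl (le_trans (lerB_dist _ _))//.
  have := le_coord_enorm (f x - f 0) i; rewrite !mxE => /le_trans; apply.
  rewrite (le_trans (fK x 0))// ler_wpM2l ?(ltW K0)//.
  by rewrite /circle_dist ge_min (ltW (arc_param_lt _ _ L0)).
have dfi i : {ae lebesgue_measure, forall x : R, derivable (fun s => f s 0 i) x 1}.
  by apply: (ae_imply f_arc) => x [/derivable_mxP dfx _]; exact: dfx.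
have mg i : measurable_fun setT (fun s => g s 0 i) by case: gq.
have gi i := Lq_circle_integrable i q1 gq.
have weak i phi : test_function L phi ->
    \int[lebesgue_measure]_(s in `[0, L[) (f s 0 i * derive1 phi s) =
    - \int[lebesgue_measure]_(s in `[0, L[) (g s 0 i * phi s).
  by move=> tphi; have := wd phi tphi i; rewrite expr1 mulN1r.
have H i := @weak_derivative_lipschitz R L K _ (fun s => f s 0 i) (fun s => g s 0 i)
  L0 (fi_lip i) (fi_bnd i) (fun x => congr1 (fun v : 'rV[R]_d => v 0 i) (pf x))
  (dfi i) (mg i) (gi i) (weak i).
split; last by move=> i; have [_] := H i.
have gf : {ae lebesgue_measure, forall x : R, forall n : nat,
    forall i : 'I_d, i = n :> nat -> 0 < x < L -> g x 0 i = derive1 (fun s => f s 0 i) x}.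
  apply: ae_foralln => n; have [nd|dn] := ltnP n d.
    have [Hn _] := H (Ordinal nd).
    by apply: (ae_imply Hn) => x Hx i /= ni; rewrite (_ : i = Ordinal nd)//; exact/val_inj.
  by apply: aeW => x i ni; have := ltn_ord i; rewrite ni ltnNge dn.
apply: (ae_imply (ae_and gf f_arc)) => x [gx [dfx f1]] x0.
rewrite -[RHS]f1; congr enorm; apply/rowP => i.
by rewrite (gx _ i erefl x0) !derive1E derive_mx// mxE.
Qed.

(** Short arcs by [near_chord], long ones by [far_chord] with [h <= L / 2]; the
    starting point is reduced to the fundamental domain by periodicity. *)
Lemma chord_ge (R : realType) (d : nat) (L p : R) (Phi : R -> R)
    (f : R -> 'rV[R]_d) : 0 < L -> 1 <= p ->
  (forall x : R, 0 < x -> 0 < Phi x) ->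
  Phi =O_ (0^'+) (fun x : R => x `^ (2 / p)) ->
  lipschitz_circle L f ->
  sobolev_Psi L 1 (Psi_of p Phi) (2 * p) f ->
  closed_embedded_curve L f -> arclength_parametrized f ->
  exists2 c, 0 < c & forall s h, 0 <= h -> h <= L / 2 ->
    c * h <= enorm (f (s + h) - f s).
Proof.
move=> L0 p1 Phi0 PhiO f_lip [_ [g [gq wd semi]]] f_emb f_arc.
have pf : periodic f L by case: f_emb.
have q1 : 1 <= 2 * p by lra.
have [g1 ftc] := weak_derivative_unit_speed L0 q1 f_lip pf f_arc gq wd.
have mg i : measurable_fun setT (fun s => g s 0 i) by case: gq.
have gi i := Lq_circle_integrable i q1 gq.
have [e e0 ie] := integrable_near_energy p1 Phi0 PhiO mg semi.
have twop : 0 < 2 `^ (- p) :> R by rewrite powR_gt0.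
have [delta [d0 id Ed]] := near_energy_small e0 twop mg ie.
pose dl := Num.min delta (L / 2).
have dl0 : 0 < dl by rewrite lt_min d0 divr_gt0.
have dlL : dl <= L / 2 by rewrite ge_min lexx orbT.
have cf i : continuous (fun x => f x 0 i).
  have [K K0 fK] := lipschitz_circle_enorm L0 f_lip.
  apply: (@lipschitz_continuous _ _ K) => x y.
  have := le_coord_enorm (f x - f y) i; rewrite !mxE => /le_trans; apply.
  by rewrite (le_trans (fK x y))// ler_wpM2l ?circle_dist_le// ltW.
have [c c0 far] := far_chord L0 dl0 dlL cf f_emb.
(* 1/2 is the bound for short arcs; long arcs have [h <= L / 2], and chords of
   length at least [c]. *)
pose c' := Num.min (2^-1) (c / (L / 2)).
have c'0 : 0 < c' by rewrite lt_min invr_gt0 ltr0n/= !divr_gt0.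
exists c' => //.
have base s h : 0 <= s -> s < L -> 0 <= h -> h <= L / 2 ->
    c' * h <= enorm (f (s + h) - f s).
  move=> s0 sL; rewrite le_eqVlt => /predU1P[<- _|h0 hL].
    by rewrite mulr0 enorm_ge0.
  have [hd|/ltW hd] := leP h dl.
    have h_le_delta : h <= delta by move: hd; rewrite le_min => /andP[].
    have hL' : h <= L by lra.
    apply: le_trans (near_chord p1 h0 h_le_delta hL' mg gi id Ed g1 ftc pf s0 sL).
    by rewrite mulrC ler_wpM2l ?(ltW h0)// ge_min lexx.
  apply: le_trans (far s h s0 (ltW sL) hd hL).
  apply: (@le_trans _ _ (c / (L / 2) * h)).
    by rewrite ler_wpM2r ?(ltW h0)// ge_min lexx orbT.
  by rewrite -mulrA ler_piMr ?(ltW c0)// mulrC ler_pdivrMr ?divr_gt0// mul1r.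
move=> s h h0 hL.
have sE : arc_param L 0 s = s - (Num.floor (s / L))%:~R * L by rewrite /arc_param subr0.
have := base (arc_param L 0 s) h (arc_param_ge0 _ _ L0) (arc_param_lt _ _ L0) h0 hL.
by rewrite sE addrAC !periodic_floor.
Qed.

Unset Implicit Arguments.

Theorem theorem2p2 (R : realType) (d : nat) (L p : R) (Phi : R -> R)
    (f : R -> 'rV[R]_d)
    (hd : (0 < d)%N) (hL : 0 < L) (hp : 1 <= p)
    (Phi_ge0 : forall x : R, 0 <= x -> 0 <= Phi x)
    (Phi_incr : forall x y : R, 0 <= x -> x < y -> Phi x < Phi y)
    (Phi0 : Phi 0 = 0)
    (PhiO : Phi =O_ (0^'+) (fun x : R => x `^ (2 / p)))
    (f_lip : lipschitz_circle L f)
    (f_sob : sobolev_Psi L 1 (Psi_of p Phi) (2 * p) f)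
    (f_emb : closed_embedded_curve L f)
    (f_arc : arclength_parametrized f) :
  bilipschitz_circle L f.
Proof.
split=> //.
have Phi_gt0 x : 0 < x -> 0 < Phi x by move=> x0; rewrite -Phi0; exact: Phi_incr.
have [c c0 chord] := chord_ge hL hp Phi_gt0 PhiO f_lip f_sob f_emb f_arc.
have [K K0 fK] := lipschitz_circle_enorm hL f_lip.
have fK' x y : enorm (f x - f y) <= K * `|x - y|.
  by rewrite (le_trans (fK x y))// ler_wpM2l ?circle_dist_le// ltW.
have pf : periodic f L by case: f_emb.
(* Chords are at least [c] times, and arc lengths at most [K] times, the parameter
   distance. *)
exists (c / K); split; first by rewrite divr_gt0.
have half x y : arc_param L x y <= arc_param L y x ->
    ((c / K)%:E * curve_length f x (x + arc_param L x y) <=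
     (enorm (f y - f x))%:E)%E.
  move=> xy; have a0 := arc_param_ge0 x y hL.
  have aL : arc_param L x y <= L / 2 by have := arc_paramD_le x y hL; lra.
  have -> : f y = f (x + arc_param L x y).
    rewrite (_ : x + _ = y - (Num.floor ((y - x) / L))%:~R * L).
      by rewrite periodic_floor.
    by rewrite /arc_param; ring.
  apply: (@le_trans _ _ ((c / K)%:E * (K * arc_param L x y)%:E)%E).
    rewrite lee_pmul2l ?lte_fin ?divr_gt0//.
    by have := curve_length_le x (x + arc_param L x y) fK'; rewrite addrAC subrr add0r.
  by rewrite -EFinM lee_fin mulrA divfK ?gt_eqF// chord.
move=> s1 s2.
have cK0 : (0 <= (c / K)%:E)%E by rewrite lee_fin divr_ge0// ltW.
have [h|/ltW h] := leP (arc_param L s1 s2) (arc_param L s2 s1).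
  apply: le_trans (half s1 s2 h); apply: lee_wpmul2l => //.
  by rewrite /intrinsic_dist ge_min lexx.
rewrite -enormN opprB; apply: le_trans (half s2 s1 h); apply: lee_wpmul2l => //.
by rewrite /intrinsic_dist ge_min lexx orbT.
Qed.
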